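(* For Lebesgue almost every $\beta\in(1,2)$ the sets $E_\beta$ and $E_\beta^+$ each contain infinitely many isolated points and infinitely many accumulation points arbitrarily close to zero, and hence their closures are not Cantor sets. On the other hand, $$\dim_H\left(\{\beta\in(1,2): \exists\,\delta>0\text{ such that }\overline{E_\beta^+}\cap[0,\delta]\text{ is a Cantor set}\}\right)=1.$$
   Context: For $\beta\in(1,2)$ the $\beta$-transformation is $T_\beta:[0,1)\to[0,1)$, $T_\beta(x)=\beta x \pmod 1$. For $t\in[0,1)$ let $K_\beta(t)=\{x\in[0,1): T_\beta^n(x)\notin(0,t)\text{ for all }n\ge 0\}$. The bifurcation set is $E_\beta=\{t\in[0,1): K_\beta(\epsilon)\neq K_\beta(t)\text{ for every }\epsilon\in(t,1)\}$, and $E_\beta^+=\{t\in[0,1): T_\beta^n(t)\ge t\text{ for all }n\ge 0\}$. The overline denotes topological closure and $\dim_H$ Hausdorff dimension. *)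

(* Defs.v *)
From mathcomp Require Import all_boot all_order all_algebra.
From mathcomp Require Import all_classical all_reals all_analysis.
Import Order.TTheory GRing.Theory Num.Theory numFieldNormedType.Exports.

Set Implicit Arguments.
Unset Strict Implicit.
Unset Printing Implicit Defensive.

Local Open Scope classical_set_scope.
Local Open Scope ring_scope.

Section BetaTransformation.
Context {R : realType}.
Implicit Types (beta t : R).

(* A total function on R; only its restriction to [0, 1[, which it maps to
   itself, is ever iterated below. *)
Definition beta_map beta (x : R) : R :=
  beta * x - (Num.floor (beta * x))%:~R.

Definition survivor beta t : set R :=
  [set x | 0 <= x < 1 /\ forall n, ~ (0 < iter n (beta_map beta) x < t)].

Definition bifurcation_set beta : set R :=
  [set t | 0 <= t < 1 /\
           forall eps, t < eps < 1 -> survivor beta eps <> survivor beta t].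

Definition bifurcation_set_plus beta : set R :=
  [set t | 0 <= t < 1 /\ forall n, t <= iter n (beta_map beta) t].

Definition infinite_near0 (A : set R) : Prop :=
  forall delta : R, 0 < delta -> infinite_set (A `&` `]0, delta[).

End BetaTransformation.

(* For subsets of the real line this is the usual notion: a nonempty compact
   perfect set without nondegenerate connected subsets. *)
Definition cantor_set {T : topologicalType} (A : set T) : Prop :=
  [/\ A !=set0, compact A, perfect_set A & totally_disconnected A].

Section HausdorffDimension.
Context {R : realType}.
Implicit Types (A U : set R) (s delta : R).
Local Open Scope ereal_scope.

(* This is -oo on the empty set. *)
Definition diam U : \bar R :=
  ereal_sup [set z | exists x y, [/\ U x, U y & z = `|x - y|%:E]].

(* diam(U)^s; the empty set weighs 0 and a singleton weighs 0^0 = 1 when s = 0,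
   so that the measure with s = 0 is the counting measure. *)
Definition diam_pow s U : \bar R :=
  if U == set0 then 0 else diam U `^ s.

Definition hausdorff_content s delta A : \bar R :=
  ereal_inf [set \sum_(0 <= k <oo) diam_pow s (U k) |
    U in [set U : (set R)^nat |
           (forall k, diam (U k) <= delta%:E) /\ A `<=` \bigcup_k U k]].

Definition hausdorff_measure s A : \bar R :=
  ereal_sup [set hausdorff_content s delta A |
    delta in [set delta : R | (0 < delta)%R]].

Definition hausdorff_dim A : \bar R :=
  ereal_inf [set s%:E | s in [set s : R | (0 <= s)%R /\
                                          hausdorff_measure s A = 0]].

End HausdorffDimension.

(* Main.v *)
(* Write P_i = T^i(1). Along an interval with constant digits T^n is affine of slope beta^n, so
   orbits of nearby points can be compared without symbolic dynamics, and t lies in E_beta iff no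
   T^n(t) lies in (0, t).

   Every beta has accumulation points near 0: t = p / beta with p the periodic point (0^N 1)^oo
   is approached by points that follow the orbit of t for a while and then restart at t.

   Suppose all P_i > 0 and 2 P_m <= P_j for all j < m. Lower the m-th digit of the expansion of 1
   to 0 and repeat: the least point of that periodic orbit is isolated in E_beta^+, since an orbit
   leaving it upwards is carried along that of 1 into [0, P_m). The least nonzero point of the orbit
   with expansion delta_1 ... delta_m 0^oo is likewise isolated in E_beta. Almost every beta has
   infinitely many such m: on the interval ]l, beta[ where the first n digits are those of beta,
   the n-th iterate of 1 is a convex function of the parameter vanishing at l, so the parameters
   near l for which n is such an m fill a fixed proportion of the interval, which Lebesgue's density
   theorem forbids for the exceptional set.

   If instead inf P_i > 0, a point of E_beta^+ near 0 can be followed for any length of time and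
   then redirected to a small periodic point, so E_beta^+ has no isolated points near 0. Such beta
   are obtained from expansions of 1 with freely chosen digits in long blocks; reading these digits
   in base 2 maps them onto [0, 1) by a Hoelder map of exponent arbitrarily close to 1. *)
Require Import Defs.
From mathcomp Require Import all_boot all_order all_algebra.
From mathcomp Require Import all_classical all_reals all_analysis.
From mathcomp Require Import measurable_realfun ring lra zify.
Import Order.TTheory GRing.Theory Num.Theory numFieldNormedType.Exports.
Local Open Scope classical_set_scope.
Local Open Scope ring_scope.

Set Implicit Arguments.
Unset Strict Implicit.
Unset Printing Implicit Defensive.

(** * Orbits under the transformation *)

Section Orbits.
Context {R : realType}.
Implicit Types (b x h : R) (n i j k : nat).

Local Notation orb b n x := (iter n (beta_map b) x).

Lemma beta_map_itv b x : 0 <= beta_map b x < 1.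
Proof.
rewrite /beta_map subr_ge0 floor_le //=.
by have := floorD1_gt (b * x); rewrite intrD; lra.
Qed.

Lemma beta_map_eq b x w (k : int) : 0 <= w < 1 -> b * x = w + k%:~R -> beta_map b x = w.
Proof.
move=> w01 E; rewrite /beta_map E (_ : Num.floor _ = k) ?addrK //.
by apply: floor_def; case/andP: w01 => w0 w1; rewrite intrD; apply/andP; split; lra.
Qed.

Lemma orb_itv b x n : 0 <= x < 1 -> 0 <= orb b n x < 1.
Proof. by case: n => [//|n] _; rewrite iterS beta_map_itv. Qed.

Lemma orb_lt1 b x n : x < 1 -> orb b n x < 1.
Proof. by case: n => [//|n] _; rewrite iterS; case/andP: (beta_map_itv b (orb b n x)). Qed.

(** The affine prediction satisfies the recursion of the orbit up to integers, so it is the orbit as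
    long as it stays in [[0, 1[]. Time 0 is exempt, which allows [x = 1]. *)
Lemma orb_shadow b x h n :
  (forall j, (0 < j <= n)%N -> 0 <= orb b j x + b ^+ j * h < 1) ->
  orb b n (x + h) = orb b n x + b ^+ n * h.
Proof.
elim: n => [_|n IH H]; first by rewrite /= mul1r.
rewrite [LHS]iterS IH; last by move=> j jn; apply: H; lia.
apply: (@beta_map_eq _ _ _ (Num.floor (b * orb b n x))); first by apply: H; lia.
by rewrite iterS {2}/beta_map exprS; ring.
Qed.

Lemma floor01 b x : 1 < b < 2 -> 0 <= x <= 1 ->
  Num.floor (b * x) = 0 \/ Num.floor (b * x) = 1.
Proof.
move=> hb hx.
have [h|h] := ltP (b * x) 1; [left|right]; apply: floor_def; apply/andP; split; nra.
Qed.

Lemma beta_map_branch b x : 1 < b < 2 -> 0 <= x <= 1 ->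
  (b * x < 1 /\ beta_map b x = b * x) \/ (1 <= b * x /\ beta_map b x = b * x - 1).
Proof.
move=> hb hx; have := beta_map_itv b x.
case: (floor01 hb hx) => E; rewrite /beta_map E ?subr0 => H; [left|right]; split => //; lra.
Qed.

Lemma orb_le b x n : 1 < b < 2 -> 0 <= x <= 1 -> orb b n x <= b ^+ n * x.
Proof.
move=> hb hx; elim: n => [|n IH]; first by rewrite mul1r.
have ho : 0 <= orb b n x <= 1.
  case: n {IH} => [//|n]; rewrite iterS; have := beta_map_itv b (orb b n x); lra.
rewrite iterS exprS; case: (beta_map_branch hb ho) => -[_ ->]; nra.
Qed.

Lemma orb0 b n : orb b n 0 = 0.
Proof. by elim: n => //= n ->; rewrite /beta_map mulr0 floor0 subr0. Qed.

Lemma finite_pos_lb (u : nat -> R) n :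
  (forall j, (j <= n)%N -> 0 < u j) -> exists2 e : R, 0 < e & forall j, (j <= n)%N -> e <= u j.
Proof.
elim: n => [|n IH] H.
  by exists (u 0%N); [exact: H|move=> j; rewrite leqn0 => /eqP->].
have [j jn|e e0 He] := IH; first by apply: H; exact: leq_trans jn _.
exists (Num.min e (u n.+1)); first by rewrite lt_min e0 H.
move=> j; rewrite leq_eqVlt => /orP[/eqP->|jn]; first by rewrite ge_min lexx orbT.
by rewrite ge_min He.
Qed.

Lemma expr_unbounded b (C : R) : 1 < b -> exists N, forall n, (N <= n)%N -> C < b ^+ n.
Proof.
move=> hb; have hb0 : 0 < b - 1 by lra.
have [N HN] : exists N : nat, C < N%:R * (b - 1).
  exists (Num.bound `|C / (b - 1)|).
  rewrite -ltr_pdivrMr //; apply: le_lt_trans (ler_norm _) _.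
  exact: archi_boundP (normr_ge0 _).
have bern n : 1 + n%:R * (b - 1) <= b ^+ n.
  elim: n => [|n IH]; first by rewrite mul0r addr0 expr0.
  rewrite exprS -natr1.
  have h1 : 0 <= n%:R * (b - 1) ^+ 2 by rewrite mulr_ge0 ?sqr_ge0.
  have h2 : b * (1 + n%:R * (b - 1)) <= b * b ^+ n by rewrite ler_wpM2l //; lra.
  lra.
exists N => n Nn; apply: lt_le_trans (bern n); apply: lt_le_trans HN _.
have : N%:R <= n%:R :> R by rewrite ler_nat.
nra.
Qed.

Lemma exprV_small b (e : R) : 1 < b -> 0 < e -> exists N, forall n, (N <= n)%N -> b ^- n < e.
Proof.
move=> hb e0; have [N HN] := expr_unbounded e^-1 hb.
exists N => n /HN H; rewrite invf_plt // posrE ?exprn_gt0 //; lra.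
Qed.

End Orbits.

(** * The two bifurcation sets *)

Section BifurcationSets.
Context {R : realType}.
Implicit Types (b x h t e : R) (n i j k : nat) (A : set R).

Local Notation orb b n x := (iter n (beta_map b) x).

Lemma orb_right b x n : 1 < b -> 0 <= x < 1 ->
  exists2 e : R, 0 < e & forall h j, 0 <= h < e -> (j <= n)%N ->
    orb b j (x + h) = orb b j x + b ^+ j * h.
Proof.
move=> hb hx; have [j _|e e0 He] := @finite_pos_lb _ (fun j => 1 - orb b j x) n.
  by rewrite subr_gt0 orb_lt1 //; case/andP: hx.
exists (e / b ^+ n); first by rewrite divr_gt0 // exprn_gt0; lra.
move=> h j /andP[h0 hlt] jn; apply: orb_shadow => i ij.
move: hlt; rewrite ltr_pdivlMr ?exprn_gt0 //; last lra.
have /He : (i <= n)%N by lia.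
have := orb_itv b i hx.
have : b ^+ i * h <= h * b ^+ n.
  by rewrite mulrC ler_wpM2l // ler_weXn2l //; (lra || lia).
have : 0 <= b ^+ i * h by rewrite mulr_ge0 // exprn_ge0; lra.
lra.
Qed.

(** Moving to the left also needs positive iterates: to the left of an iterate equal to 0 the orbit
    jumps close to 1. *)
Lemma orb_near b x n : 1 < b -> (forall j, (0 < j <= n)%N -> 0 < orb b j x) ->
  exists2 e : R, 0 < e & forall h j, `|h| < e -> (j <= n)%N ->
    orb b j (x + h) = orb b j x + b ^+ j * h.
Proof.
move=> hb hx.
have [j jn|e e0 He] :=
    @finite_pos_lb _ (fun j => Num.min (1 - orb b j.+1 x) (if (j < n)%N then orb b j.+1 x else 1)) n.
  rewrite lt_min subr_gt0 iterS; case/andP: (beta_map_itv b (orb b j x)) => _ -> /=.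
  by case: ifP => // jn'; rewrite -iterS hx.
exists (e / b ^+ n); first by rewrite divr_gt0 // exprn_gt0; lra.
move=> h j hlt jn; apply: orb_shadow => -[//|i] ij.
move: hlt; rewrite ltr_pdivlMr ?exprn_gt0 //; last lra.
have /He : (i <= n)%N by lia.
rewrite le_min (_ : (i < n)%N); last lia.
have : `|b ^+ i.+1 * h| <= `|h| * b ^+ n.
  rewrite normrM mulrC ler_wpM2l // ger0_norm ?exprn_ge0 ?ler_weXn2l //; (lra || lia).
rewrite ler_norml => /andP[H1 H2] /andP[H3 H4]; lra.
Qed.

(** If [T^n(t)] lies in [(0, t)], the same affine branch carries [[t, t + d[] into [(0, t)], so the
    holes [(0, t)] and [(0, t + d)] have the same survivors. Conversely, such a [t > 0] survives its
    own hole but no larger one. *)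
Lemma bifurcation_setP b t : 1 < b ->
  bifurcation_set b t <-> 0 <= t < 1 /\ forall n, ~ (0 < orb b n t < t).
Proof.
move=> hb; split=> [[t01 Et]|[t01 Et]]; split=> //.
  move=> n /andP[h0 ht].
  have [e e0 He] := orb_right n hb t01.
  (* [d] keeps the affine regime valid, [t + d] below 1 and [orb b n t + b ^+ n * d] below [t]. *)
  pose d := Num.min (Num.min (e / 2) ((1 - t) / 2)) ((t - orb b n t) / (2 * b ^+ n)).
  have bn : 0 < b ^+ n by rewrite exprn_gt0; lra.
  have d0 : 0 < d.
    by rewrite !lt_min !divr_gt0 ?subr_gt0 ?mulr_gt0 //; case/andP: t01.
  have de : d <= e / 2 by rewrite /d !ge_min lexx.
  have d1 : d <= (1 - t) / 2 by rewrite /d !ge_min lexx orbT.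
  have dn : d * (2 * b ^+ n) <= t - orb b n t.
    by rewrite -ler_pdivlMr ?mulr_gt0 // /d !ge_min lexx !orbT.
  case: (Et (t + d)); first by apply/andP; split; lra.
  apply/seteqP; split=> x [x01 Hx]; split=> // k /andP[k0 k1].
    by apply: (Hx k); apply/andP; split; lra.
  have [klt|kge] := ltP (orb b k x) t; first by apply: (Hx k); rewrite k0 klt.
  apply: (Hx (n + k)%N); rewrite iterD.
  have -> : orb b k x = t + (orb b k x - t) by lra.
  rewrite He //; last by apply/andP; split; lra.
  have : b ^+ n * (orb b k x - t) <= b ^+ n * d by rewrite ler_pM2l //; lra.
  have : 0 <= b ^+ n * (orb b k x - t) by rewrite mulr_ge0 ?(ltW bn) ?subr_ge0.
  by move=> *; apply/andP; split; lra.
move=> eps /andP[te e1] E.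
have [t0|t0] := ltP 0 t.
  have : survivor b t t by split.
  by rewrite -E => -[_ /(_ 0%N)] /=; rewrite t0 te.
(* For [t = 0] the hole is empty, while [eps / 2] starts inside the hole of [eps]. *)
have : survivor b t (eps / 2).
  split=> [|n]; first by apply/andP; split; lra.
  by move=> /andP[]; lra.
rewrite -E => -[_ /(_ 0%N)] /=; case; apply/andP; split; lra.
Qed.

Lemma bifurcation_set_plus_sub b : 1 < b -> bifurcation_set_plus b `<=` bifurcation_set b.
Proof.
move=> hb t [t01 Ht]; apply/bifurcation_setP => //; split=> // n /andP[_].
by have := Ht n; lra.
Qed.

Lemma infinite_near0W A :
  (forall d : R, 0 < d -> exists2 x, A x & 0 < x < d) -> infinite_near0 A.
Proof.
move=> H d d0 /finite_seqP[s Es].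
have [e e0 He] : exists2 e : R, 0 < e & forall x, x \in s -> 0 < x -> e <= x.
  elim: s {Es} => [|y s [e e0 He]]; first by exists 1.
  have [y0|y0] := ltP 0 y.
    exists (Num.min e y); first by rewrite lt_min e0.
    move=> x; rewrite inE => /orP[/eqP->|xs] x0; first by rewrite ge_min lexx orbT.
    by rewrite ge_min He.
  exists e => // x; rewrite inE => /orP[/eqP->|]; [lra|exact: He].
have [|x Ax /andP[x0]] := H (Num.min d e); first by rewrite lt_min d0.
rewrite lt_min => /andP[xd xe].
have : [set` s] x by rewrite -Es; split => //=; rewrite in_itv /= x0.
by move=> /= /He /(_ x0); lra.
Qed.

Lemma isolatedW A t e : A t -> 0 < e ->
  (forall y, `|y - t| < e -> A y -> y = t) -> isolated A t.
Proof.
move=> At e0 H; split; first by rewrite inE.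
exists (ball t e); first exact: nbhsx_ballx.
apply/seteqP; split=> [y [By Ay]|y ->]; last by split=> //; exact: ballxx.
by apply: H => //; rewrite distrC.
Qed.

Lemma limit_pointW A t :
  (forall e : R, 0 < e -> exists2 y, A y & 0 < `|y - t| < e) -> limit_point A t.
Proof.
move=> H U /nbhs_ballP[e /= e0 He]; have [y Ay /andP[y0 ye]] := H e e0.
exists y; split=> //; first by rewrite -subr_eq0 -normr_gt0.
by apply: He; rewrite /ball /= distrC.
Qed.

(** An isolated point of [A] has an open neighbourhood without other points of [A]. Removing the
    point leaves an open set disjoint from [A], hence from its closure, which is therefore not
    perfect. *)
Lemma isolated_closure_not_cantor A : isolated A !=set0 -> ~ cantor_set (closure A).
Proof.
move=> [t [/set_mem At [V Vt EV]]] [_ _ /perfectP[_ I0] _].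
suff : isolated (closure A) t by rewrite I0.
split; first by rewrite inE; exact: subset_closure.
exists V°; first exact: nbhs_interior.
apply/seteqP; split=> [y [Vy cAy]|y ->]; last by split=> //; exact: subset_closure.
apply: contrapT => /eqP yt.
have [z [Az [Vz zt]]] : A `&` (V° `&` ~` [set t]) !=set0.
  apply: cAy; apply: filterI; first by apply: open_nbhs_nbhs; split=> //; exact: open_interior.
  apply: open_nbhs_nbhs; split; last by move=> /= E; rewrite E eqxx in yt.
  exact/closed_openC/accessible_closed_set1/hausdorff_accessible/Rhausdorff.
have : (V `&` A) z by split=> //; exact: interior_subset.
by rewrite EV => /zt.
Qed.

End BifurcationSets.

(** * Accumulation points *)

Section AccumulationPoints.
Context {R : realType}.
Implicit Types (b x h t e : R) (n m i j k : nat).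

Local Notation orb b n x := (iter n (beta_map b) x).

Lemma orb_periodic b x m n : (0 < m)%N -> orb b m x = x -> orb b n x = orb b (n %% m) x.
Proof.
move=> m0 E; rewrite {1}(divn_eq n m) addnC iterD; congr iter.
by elim: (n %/ m)%N => // k IH; rewrite mulSn addnC iterD E.
Qed.

(** The point [x + h] shadows [x] for [n] steps and then lands on a point whose future is known.
    This is how points of [E_beta^+] close to a given one are produced. *)
Lemma bifurcation_set_plus_landing b x h n : 0 <= x + h < 1 ->
  (forall j, (0 < j <= n)%N -> x + h <= orb b j x + b ^+ j * h < 1) ->
  (forall i, x + h <= orb b i (orb b n x + b ^+ n * h)) ->
  bifurcation_set_plus b (x + h).
Proof.
move=> h01 H1 H2; split=> // k.
have S j : (j <= n)%N -> orb b j (x + h) = orb b j x + b ^+ j * h.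
  move=> jn; apply: orb_shadow => i ij.
  have /H1 : (0 < i <= n)%N by lia.
  by case/andP: h01 => *; apply/andP; split; lra.
have [kn|nk] := leqP k n; last first.
  by rewrite -(subnK (ltnW nk)) iterD S.
rewrite S //; case: k kn => [|k] kn; first by rewrite /= mul1r.
by have /H1/andP[] : (0 < k.+1 <= n)%N by lia.
Qed.

(* p has the greedy expansion (0^N 1)^oo, with N large. *)
Lemma small_periodic b e : 1 < b < 2 -> 0 < e ->
  exists p m, [/\ 0 < p < e, (0 < m)%N, orb b m p = p & bifurcation_set_plus b p].
Proof.
move=> /andP[hb hb2] e0; have b0 : 0 < b by lra.
have [N HN] := expr_unbounded (1 + e^-1 + (b - 1)^-1) hb.
have bN := HN _ (leqnn N); have bN1 := HN _ (leqnSn N).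
have ei : 0 < e^-1 by rewrite invr_gt0.
have bi : 0 < (b - 1)^-1 by rewrite invr_gt0; lra.
set D := b ^+ N.+1 - 1; have D0 : 0 < D by rewrite /D; lra.
have Di : 0 < D^-1 by rewrite invr_gt0.
have DD : D^-1 * D = 1 by rewrite mulVf //; lra.
have pe : D^-1 < e by rewrite invf_plt ?posrE // /D; lra.
(* Since [b ^+ N * (b - 1) > 1], the iterates up to time [N] do not wrap around; the digit 1 occurs
   only at step [N + 1]. *)
have bNp : b ^+ N * D^-1 < 1.
  rewrite ltr_pdivrMr // mul1r /D exprS.
  have : (b - 1)^-1 * (b - 1) = 1 by rewrite mulVf //; lra.
  nra.
have H k : (k <= N)%N -> orb b k D^-1 = b ^+ k * D^-1.
  elim: k => [|k IH] kN; first by rewrite mul1r.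
  rewrite iterS IH ?(ltnW kN) //.
  apply: (@beta_map_eq _ _ _ _ 0); last by rewrite addr0 mulrA -exprS.
  rewrite mulr_ge0 ?exprn_ge0 ?(ltW Di) ?(ltW b0) //=.
  apply: le_lt_trans bNp; rewrite ler_pM2r // ler_weXn2l //; lra.
have HN1 : orb b N.+1 D^-1 = D^-1.
  rewrite iterS H //; apply: (@beta_map_eq _ _ _ _ 1).
    rewrite (ltW Di) /=; apply: le_lt_trans bNp.
    by rewrite ler_peMl ?(ltW Di) // exprn_ege1 //; lra.
  by rewrite mulrA -exprS; move: DD; rewrite /D; lra.
exists D^-1, N.+1; split=> //; first by rewrite Di.
have Hge n : D^-1 <= orb b n D^-1.
  rewrite (orb_periodic _ _ HN1) // H; last by rewrite -ltnS ltn_mod.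
  by rewrite ler_peMl ?(ltW Di) // exprn_ege1 //; lra.
split=> //; rewrite (ltW Di) /=; apply: le_lt_trans bNp.
by rewrite ler_peMl ?(ltW Di) // exprn_ege1 //; lra.
Qed.

Lemma accumulation_near0 b : 1 < b < 2 ->
  infinite_near0 (bifurcation_set_plus b `&` limit_point (bifurcation_set_plus b)).
Proof.
move=> hb; case/andP: (hb) => b1 b2; have b0 : 0 < b by lra.
apply: infinite_near0W => d d0.
have [p [m [/andP[p0 pd] m0 Em [/andP[_ p1] Hp]]]] := small_periodic hb d0.
set t := p / b.
have t0 : 0 < t by rewrite divr_gt0.
have tp : t < p by rewrite ltr_pdivrMr //; nra.
have Et : beta_map b t = p.
  apply: (@beta_map_eq _ _ _ _ 0); first by rewrite (ltW p0).
  by rewrite addr0 /t mulrC divfK //; lra.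
have Ht j : (0 < j)%N -> p <= orb b j t.
  by case: j => // j _; rewrite iterSr Et.
have HtE : bifurcation_set_plus b t.
  split; first by apply/andP; split; lra.
  by case=> [//|j]; have := Ht j.+1 isT; lra.
exists t; last by rewrite t0 (lt_trans tp).
split=> //; apply: limit_pointW => e e0.
have [N HN] := exprV_small b1 e0.
(* One step takes [t] to [p], and [N] periods return to [p]. *)
set n := (N * m).+1.
have Hn : orb b n t = p.
  by rewrite iterSr Et (orb_periodic _ m0 Em) modnMl.
have bn : b ^- n < e by apply: HN; rewrite /n; nia.
have bn0 : 0 < b ^- n by rewrite invr_gt0 exprn_gt0.
have bnn : b ^+ n * b ^- n = 1 by rewrite mulfV // gt_eqF // exprn_gt0.
(* At time [n] the correction is [t - p], so [t + h] lands exactly on [t]. The iterates of [t] at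
   positive times are at least [p] and lose at most [p - t]. *)
set h := - (b ^- n * (p - t)).
have h0 : 0 < b ^- n * (p - t) by rewrite mulr_gt0 // subr_gt0.
have hh : b ^- n * (p - t) <= b ^- n by rewrite ler_piMr ?(ltW bn0) //; lra.
have hj j : (j <= n)%N -> - (p - t) <= b ^+ j * h <= 0.
  move=> jn; have bj : 0 < b ^+ j by rewrite exprn_gt0.
  rewrite /h mulrN; apply/andP; split; last by rewrite oppr_le0 mulr_ge0 ?ltW.
  rewrite lerN2 mulrA ler_piMl //; first by lra.
  by rewrite ler_pdivrMr ?exprn_gt0 // mul1r ler_weXn2l //; lra.
exists (t + h); last by rewrite /h addrAC subrr add0r normrN gtr0_norm // h0; lra.
have Hnh : orb b n t + b ^+ n * h = t by rewrite Hn /h mulrN mulrA bnn; lra.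
have h1 : - (p - t) <= h by have := hj 0%N isT; rewrite mul1r => /andP[].
have h2 : h < 0 by rewrite /h; lra.
have hjt j : (0 < j <= n)%N -> t <= orb b j t + b ^+ j * h < 1.
  move=> /andP[j0 jn]; have := hj j jn; have := Ht j j0.
  have := orb_lt1 b j (_ : t < 1); move=> /(_ (lt_trans tp p1)).
  by move=> ? ? /andP[? ?]; apply/andP; split; lra.
apply: (bifurcation_set_plus_landing (n := n)).
- have /hjt : (0 < 1 <= n)%N by [].
  have bn1 : b ^- n <= b ^-1 by rewrite lef_pV2 ?posrE ?exprn_gt0 // /n exprS ler_peMr ?(ltW b0) // exprn_ege1 // ltW.
  have : b ^- n * (p - t) <= b^-1 * (p - t) by rewrite ler_wpM2r //; lra.
  have : b^-1 * p = t by rewrite mulrC.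
  have : 0 < b^-1 * t by rewrite mulr_gt0 ?invr_gt0.
  by rewrite /h => *; apply/andP; split; lra.
- by move=> j jn; have := hjt j jn; move=> /andP[? ?]; apply/andP; split; lra.
- by move=> i; rewrite Hnh; case: HtE => _ /(_ i); lra.
Qed.

Lemma limit_point_sub (A B : set R) : A `<=` B -> limit_point A `<=` limit_point B.
Proof.
move=> AB x Hx U /Hx[y [yx Ay Uy]]; exists y; split=> //; exact: AB.
Qed.

End AccumulationPoints.

(** * Isolated points *)

Section IsolatedPoints.
Context {R : realType}.
Implicit Types (b x h t e z : R) (n m i j k : nat).

Local Notation orb b n x := (iter n (beta_map b) x).

(** The factor 2 lets a point shadow the orbit of 1 before time [m] with an error of up to [P_m] and
    still stay at height at least [P_m]. *)
Definition halving_time b m : Prop :=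
  0 < orb b m 1 /\ forall j, (j < m)%N -> 2 * orb b m 1 <= orb b j 1.

Lemma exists_argmin (u : nat -> R) m : (0 < m)%N ->
  exists2 i, (i < m)%N & forall j, (j < m)%N -> u i <= u j.
Proof.
elim: m => // -[_ _|m IH _]; first by exists 0%N => // -[].
have [i im Hi] := IH isT.
have [h|h] := leP (u i) (u m.+1).
  exists i => [|j]; first lia.
  by rewrite ltnS leq_eqVlt => /orP[/eqP->//|/Hi].
exists m.+1 => // j; rewrite ltnS leq_eqVlt => /orP[/eqP->//|/Hi]; lra.
Qed.

Lemma beta_map_eq0 b x : 1 < b < 2 -> 0 < x < 1 -> beta_map b x = 0 -> b * x = 1.
Proof.
move=> hb hx E; have bx : 0 < b * x by rewrite mulr_gt0; lra.
have hx1 : 0 <= x <= 1 by lra.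
by case: (beta_map_branch hb hx1) => -[_]; rewrite E; lra.
Qed.

(** Shadowing with [x = 1]: a downward correction can only violate the bound 0, since the later
    iterates of 1 are below 1. *)
Lemma orb_near_one b z k : 1 < b -> z <= 1 ->
  (forall j, (j <= k)%N -> b ^+ j * (1 - z) <= orb b j 1) ->
  forall j, (j <= k)%N -> orb b j z = orb b j 1 - b ^+ j * (1 - z).
Proof.
move=> hb z1 H j jk.
have E : z = 1 + (z - 1) by lra.
rewrite {1}E orb_shadow; first by rewrite mulrBr mulrBr; lra.
move=> i /andP[i0 ij]; have /H : (i <= k)%N by lia.
have : 0 <= b ^+ i * (1 - z) by rewrite mulr_ge0 ?exprn_ge0; lra.
have : orb b i 1 < 1.
  by case: i i0 {ij} => // i _; rewrite iterS; case/andP: (beta_map_itv b (orb b i 1)).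
by move=> *; apply/andP; split; lra.
Qed.

(** Let [t] be the least of the first [m] iterates of a point [z] with [T^m(z) = 0]. Points just
    above [t] are carried just above 0, hence into the hole. Points just below [t] are carried just
    below 1 and then along the orbit of 1 to just below [P_m < t]. *)
Lemma isolated_bifurcation_set b m : 1 < b < 2 -> (0 < m)%N -> halving_time b m ->
  exists t, [/\ isolated (bifurcation_set b) t, 0 < t & forall j, (j < m)%N -> t < orb b j 1].
Proof.
move=> /andP[hb hb2] m0 [Pm0 HP]; have b0 : 0 < b by lra.
set P := orb b m 1 in Pm0 HP.
have bgt0 k : 0 < b ^+ k by rewrite exprn_gt0.
have bmi : b ^+ m * b ^- m = 1 by rewrite mulfV // gt_eqF.
(* The error [b ^+ j * (1 - z)] reaches [P] exactly at time [m], where it cancels the iterate of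
   1. *)
pose z := 1 - b ^- m * P.
have z1 : 1 - z = b ^- m * P by rewrite /z; lra.
have zp : 0 < 1 - z by rewrite z1 mulr_gt0 // invr_gt0.
have bj j : (j < m)%N -> b ^+ j * (1 - z) < P.
  move=> jm; have : b ^+ j * (1 - z) < b ^+ m * (1 - z) by rewrite ltr_pM2r // ltr_eXn2l.
  by rewrite [in X in _ < X]z1 mulrA bmi mul1r.
have zm : b ^+ m * (1 - z) = P by rewrite z1 mulrA bmi mul1r.
have Hz j : (j <= m)%N -> orb b j z = orb b j 1 - b ^+ j * (1 - z).
  apply: orb_near_one => // [|i]; first by rewrite /z; lra.
  rewrite leq_eqVlt => /orP[/eqP->|im]; first by rewrite zm.
  by have := HP i im; have := bj i im; lra.
have Ezm : orb b m z = 0 by rewrite Hz // zm subrr.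
have Hzj j : (j < m)%N -> P < orb b j z < orb b j 1.
  move=> jm; rewrite Hz ?(ltnW jm) //.
  have := HP j jm; have := bj j jm; have : 0 < b ^+ j * (1 - z) by rewrite mulr_gt0.
  by move=> *; apply/andP; split; lra.
have [i im Hi] := @exists_argmin (fun j => orb b j z) m m0.
set t := orb b i z in Hi.
have [mi mm mi_m] : [/\ ((m - i).-1 + i)%N = m.-1, (m.-1 < m)%N & (m - i <= m)%N].
  by move: im m0; clear; split; lia.
have /andP[tP _] := Hzj i im; rewrite -/t in tP.
have t1 : t < 1 by apply: orb_lt1; lra.
have orbt k : orb b k t = orb b (k + i) z by rewrite iterD.
have t01 : 0 <= t < 1 by apply/andP; split; lra.
have [e1 e10 He1] := orb_right (m - i) hb t01.
have [|e2 e20 He2] := @orb_near _ b t (m - i).-1 hb.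
  move=> j /andP[_ jm]; rewrite orbt.
  have jm' : (j + i < m)%N by rewrite -(prednK m0) ltnS -mi leq_add2r.
  by case/andP: (Hzj _ jm') => h _; exact: lt_trans Pm0 h.
(* Deviations are followed for at most [2 * m] steps: up to the end of the orbit of [z], then [m]
   steps along that of 1. *)
have q0 : 0 < P / b ^+ (2 * m) by rewrite divr_gt0.
exists t; split; last 2 first.
- by lra.
- by move=> j jm; apply: le_lt_trans (Hi j jm) _; case/andP: (Hzj j jm).
apply: (@isolatedW _ _ _ (Num.min (Num.min e1 e2) (Num.min (P / b ^+ (2 * m)) (t - P)))).
- apply/bifurcation_setP => //; split=> // n; rewrite orbt => /andP[h0 ht].
  have [nm|nm] := ltnP (n + i) m; first by have := Hi _ nm; lra.
  by move: h0; rewrite -(subnK nm) iterD Ezm orb0 ltxx.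
- by rewrite !lt_min e10 e20 q0; lra.
move=> y; rewrite !lt_min ltr_pdivlMr // -!andbA => /and4P[y1 y2 y3 y4].
move=> /(bifurcation_setP _ hb)[/andP[yge0 ylt1] Ey].
have yt : y = t + (y - t) by lra.
have [h|h|//] := ltgtP y t.
- have habs : `|y - t| = t - y by rewrite ltr0_norm; lra.
  exfalso; apply: (Ey (m + (1 + (m - i).-1))%N).
  have E1 : orb b (m - i).-1 y = orb b m.-1 z + b ^+ (m - i).-1 * (y - t).
    by rewrite {1}yt He2 // orbt mi.
  (* The iterate before 0 is [1 / b], so a point slightly to its left is sent just below 1. *)
  have bz : b * orb b m.-1 z = 1.
    have /andP[zz0 _] := Hzj m.-1 mm.
    apply: beta_map_eq0; rewrite ?b1 ?hb //; last by rewrite -iterS prednK.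
    by rewrite (lt_trans Pm0) // orb_lt1 // -subr_gt0.
  have sm : b ^+ (m - i) * (t - y) <= (t - y) * b ^+ m.
    by rewrite mulrC ler_pM2l ?subr_gt0 // ler_weXn2l // ltW.
  have E2m : (t - y) * b ^+ m * b ^+ m = (t - y) * b ^+ (2 * m).
    by rewrite mul2n -addnn exprD mulrA.
  have sm1 : (t - y) * b ^+ m <= (t - y) * b ^+ (2 * m).
    by rewrite ler_pM2l ?subr_gt0 // ler_weXn2l ?(ltW hb) // leq_pmull.
  have sm2 : b ^+ m * (b ^+ (m - i) * (t - y)) <= (t - y) * b ^+ (2 * m).
    by rewrite -E2m mulrC ler_wpM2r // ltW.
  have sm0 : 0 < b ^+ (m - i) * (t - y) by rewrite mulr_gt0 //; lra.
  have P1 : P < 1 by have := HP 0%N m0; rewrite /=; lra.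
  have E2 : orb b (1 + (m - i).-1) y = 1 - b ^+ (m - i) * (t - y).
    rewrite iterS E1; apply: (@beta_map_eq _ _ _ _ 0).
      by apply/andP; split; move: y3; rewrite habs; lra.
    rewrite mulrDr bz mulrA -exprS prednK ?subn_gt0 //; lra.
  rewrite iterD E2 (@orb_near_one _ _ m) //.
  + rewrite -/P (_ : 1 - (1 - _) = b ^+ (m - i) * (t - y)); last by lra.
    have : 0 < b ^+ m * (b ^+ (m - i) * (t - y)) by rewrite mulr_gt0.
    by move: y3 y4; rewrite habs => *; apply/andP; split; lra.
  + by lra.
  + move=> j jm; rewrite (_ : 1 - (1 - _) = b ^+ (m - i) * (t - y)); last by lra.
    have h1 : b ^+ j * (b ^+ (m - i) * (t - y)) <= b ^+ m * (b ^+ (m - i) * (t - y)).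
      by rewrite ler_wpM2r ?(ltW sm0) // ler_weXn2l //; lra.
    have h2 : P <= orb b j 1.
      by move: jm; rewrite leq_eqVlt => /orP[/eqP->//|/HP]; lra.
    by move: y3; rewrite habs; lra.
- have habs : `|y - t| = y - t by rewrite gtr0_norm; lra.
  exfalso; apply: (Ey (m - i)%N).
  rewrite yt He1 //; last by rewrite -habs y1 normr_ge0.
  rewrite orbt subnK ?(ltnW im) // Ezm add0r mulr_gt0 ?subr_gt0 //=.
  have : b ^+ (m - i) * (y - t) <= (y - t) * b ^+ (2 * m).
    by rewrite mulrC ler_pM2l ?subr_gt0 // ler_weXn2l ?(ltW hb) // (leq_trans mi_m) // leq_pmull.
  by move: y3; rewrite habs; lra.
Qed.

(** * Periodic orbits with a point isolated in [E_beta^+] *)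

Section IsolatedPlus.
Context (b : R) (m : nat) (hb : 1 < b < 2) (m0 : (0 < m)%N) (hm : halving_time b m).
Context (bm : 1 <= b ^+ m.-1 * (b - 1)).

Let P := orb b m 1.
(** Shadowing 1 with initial error [g] and lowering the last digit gives
    [P - b ^+ m * g + 1 = 1 - g], so [c = 1 - g] has period [m]. *)
Let g := P / (b ^+ m - 1).
Let c := 1 - g.

Let b1 : 1 < b. Proof. by case/andP: hb. Qed.
Let b0 : 0 < b. Proof. by have := b1; lra. Qed.
Let bgt0 k : 0 < b ^+ k. Proof. exact: exprn_gt0 b0. Qed.
Let P0 : 0 < P. Proof. by case: hm. Qed.
(** Hence the error [g] grows to at most [P] within [m - 1] steps, and halving keeps the orbit of
    [c] at or above [P]. *)
Let bm1 : b ^+ m.-1 <= b ^+ m - 1.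
Proof. by rewrite -{2}(prednK m0) exprS; have := bm; lra. Qed.
Let gP : b ^+ m * g = P + g.
Proof.
have d0 : b ^+ m - 1 != 0 by rewrite gt_eqF //; have := bm1; have := bgt0 m.-1; lra.
have : g * (b ^+ m - 1) = P by rewrite /g divfK.
lra.
Qed.
Let g0 : 0 < g.
Proof. by rewrite divr_gt0 //; have := bm1; have := bgt0 m.-1; lra. Qed.
Let bj j : (j < m)%N -> b ^+ j * g <= P.
Proof.
move=> jm; apply: (@le_trans _ _ (b ^+ m.-1 * g)).
  by rewrite ler_wpM2r ?(ltW g0) // ler_weXn2l ?ltW // -ltnS prednK.
have : b ^+ m.-1 * g <= (b ^+ m - 1) * g by rewrite ler_wpM2r ?(ltW g0).
by have := gP; lra.
Qed.
Let uj j : (j < m)%N -> P <= orb b j 1 - b ^+ j * g.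
Proof. by move=> jm; have := bj jm; case: hm => _ /(_ j jm); rewrite -/P; lra. Qed.
Let E1c : 1 - c = g. Proof. by rewrite /c; lra. Qed.
Let orbc j : (j < m)%N -> orb b j c = orb b j 1 - b ^+ j * g.
Proof.
move=> jm; rewrite (@orb_near_one _ _ m.-1) ?E1c //; first by have := g0; rewrite /c; lra.
  move=> i im; have /uj : (i < m)%N by rewrite -(prednK m0) ltnS.
  by have := P0; lra.
by rewrite -ltnS prednK.
Qed.
Let c0 : P <= c. Proof. by have := uj m0; rewrite /= mul1r. Qed.

(* One period after z, the orbit is carried along that of 1 with the error [1 - z]. *)
Let orb_period z : c <= z < 1 ->
  let w := P - b ^+ m * (1 - z) in orb b m z = if 0 <= w then w else w + 1.
Proof.
move=> /andP[cz z1] w.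
have hk j : (j < m)%N -> b ^+ j * (1 - z) <= orb b j 1.
  move=> jm; have : b ^+ j * (1 - z) <= b ^+ j * g.
    by rewrite ler_wpM2l ?(ltW (bgt0 _)) //; have := E1c; lra.
  by have := uj jm; have := P0; lra.
have w1 : - 1 <= w.
  have : b ^+ m * (1 - z) <= b ^+ m * g.
    by rewrite ler_wpM2l ?(ltW (bgt0 _)) //; have := E1c; lra.
  by have := gP; have := c0; have := P0; rewrite /w; have := E1c; lra.
have wP : w < P by rewrite /w ltrBlDr ltrDl mulr_gt0 // subr_gt0.
have P1 : P < 1 by case: hm => _ /(_ 0%N m0) /=; rewrite -/P; have := P0; lra.
rewrite -{1}(prednK m0) iterS (@orb_near_one _ _ m.-1) ?(ltW z1) //; last first.
  by move=> j jm; apply: hk; rewrite -(prednK m0) ltnS.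
have E : b * (orb b m.-1 1 - b ^+ m.-1 * (1 - z)) = w + (Num.floor (b * orb b m.-1 1))%:~R.
  have EP : P = b * orb b m.-1 1 - (Num.floor (b * orb b m.-1 1))%:~R.
    by rewrite /P -{1}(prednK m0) iterS.
  by rewrite mulrBr mulrA -exprS prednK // /w EP; lra.
case: ifP => [w0|/negbT]; last rewrite -ltNge => w0.
  by apply: beta_map_eq E; rewrite w0; lra.
apply: (@beta_map_eq _ _ _ _ (Num.floor (b * orb b m.-1 1) - 1)).
  by apply/andP; split; lra.
by rewrite E intrB; lra.
Qed.

Let orbm : orb b m c = c.
Proof.
rewrite orb_period ?lexx /=; last by have := g0; rewrite /c; lra.
rewrite E1c gP ifF; first by rewrite /c; lra.
by apply/negbTE; rewrite -ltNge; have := g0; lra.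
Qed.

(** Each period either lands in [[0, P)] or multiplies the distance to [c] by [b ^+ m]. The latter
    cannot happen [q] times, as the orbit stays below 1. *)
Let escape q z : c < z < 1 -> 1 <= c + b ^+ (m * q) * (z - c) ->
  exists k, orb b k z < P.
Proof.
elim: q z => [|q IH] z /andP[cz z1]; first by rewrite muln0 mul1r; lra.
move=> hq; have := @orb_period z; rewrite (ltW cz) z1 => /(_ isT) /=.
case: ifP => [_ E|/negbT]; last rewrite -ltNge => w0 E.
  by exists m; rewrite E ltrBlDr ltrDl mulr_gt0 // subr_gt0.
have E2 : orb b m z - c = b ^+ m * (z - c).
  by have := gP; rewrite E -E1c; lra.
have [|| k Hk] := IH (orb b m z).
- by rewrite -subr_gt0 E2 mulr_gt0 ?subr_gt0 //= E; lra.
- by rewrite E2 mulrA -exprD addnC -mulnS.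
by exists (k + m)%N; rewrite iterD.
Qed.

Lemma isolated_bifurcation_set_plus :
  exists t, [/\ isolated (bifurcation_set_plus b) t, 0 < t &
    forall j, (j < m)%N -> t < orb b j 1].
Proof.
have [i im Hi] := @exists_argmin (fun j => orb b j c) m m0.
set t := orb b i c in Hi.
have c1 : c < 1 by have := g0; rewrite /c; lra.
have tP : P <= t by rewrite /t orbc // uj.
have t0 : 0 < t := lt_le_trans P0 tP.
have orbt k : orb b k t = orb b ((k + i) %% m) c.
  by rewrite /t -iterD (orb_periodic _ _ orbm).
have t1 : t < 1 by apply: orb_lt1.
have tle k : t <= orb b k t by rewrite orbt Hi // ltn_mod.
have [|e e0 He] := @orb_near _ b t m b1.
  by move=> j _; apply: lt_le_trans (tle j).
exists t; split=> //; last first.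
  move=> j jm; apply: le_lt_trans (Hi j jm) _; rewrite orbc //.
  by rewrite ltrBlDr ltrDl mulr_gt0.
apply: (@isolatedW _ _ _ e) => //.
  by split=> //; rewrite (ltW t0).
move=> y hy [/andP[yge0 ylt1] Ey].
have yt : y = t + (y - t) by lra.
(* Below [t], one period pushes [y] below itself. Above [t], [m - i] steps lead to a point above
   [c], from which the orbit escapes below [P <= t]. *)
have [h|h|//] := ltgtP y t.
  have := Ey m; rewrite {2}yt He // orbt -modnDml modnn add0n modn_small // -/t.
  have : 1 < b ^+ m by rewrite exprn_egt1 ?b1 // -lt0n.
  by nra.
have Ez : orb b (m - i) y = c + b ^+ (m - i) * (y - t).
  by rewrite {1}yt He ?leq_subr // orbt subnK ?(ltnW im) // modnn.
set z := orb b (m - i) y in Ez.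
have cz : c < z < 1 by rewrite orb_lt1 // andbT Ez ltrDl mulr_gt0 // subr_gt0.
have [N HN] := expr_unbounded (z - c)^-1 b1.
have [||k Hk] := @escape N z => //.
  have zc0 : 0 < z - c by case/andP: cz; lra.
  have h1 : (z - c)^-1 <= b ^+ (m * N) by apply/ltW/HN; rewrite leq_pmull.
  rewrite -(ler_pM2r zc0) mulVf ?lt0r_neq0 // in h1.
  by have := c0; have := P0; lra.
by have := Ey (k + (m - i))%N; rewrite iterD -/z; lra.
Qed.

End IsolatedPlus.

(** Along successive halving times the iterates of 1 at least halve, and the isolated point built
    from [m] lies below every earlier iterate of 1. *)
Lemma isolated_near0 b : 1 < b < 2 ->
  (forall n, exists2 m, (n <= m)%N & halving_time b m) ->
  infinite_near0 (isolated (bifurcation_set b)) /\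
  infinite_near0 (isolated (bifurcation_set_plus b)).
Proof.
move=> hb H; case/andP: (hb) => b1 b2.
have small k : exists2 m, (k <= m)%N & orb b m 1 <= 2 ^- k.
  elim: k => [|k [m km Hm]].
    have [m _ [_ Hm]] := H 1%N; exists m => //; rewrite invr1.
    by case: m Hm => [//|m] Hm; have := beta_map_itv b (orb b m 1); rewrite iterS; lra.
  have [m' mm' [_ Hm']] := H m.+1; exists m'; first lia.
  rewrite exprS invfM; have := Hm' m mm'; lra.
have key d : 0 < d -> exists m, [/\ (0 < m)%N, halving_time b m,
    1 <= b ^+ m.-1 * (b - 1) & exists2 j, (j < m)%N & orb b j 1 < d].
  move=> d0; have [|N HN] := @exprV_small _ 2 d _ d0; first lra.
  have [j Nj Hj] := small N.
  have [M HM] := expr_unbounded (b - 1)^-1 b1.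
  have [m hm Hm] := H (maxn j M).+1.
  exists m; split=> //; first by lia.
    have b10 : 0 < b - 1 by lra.
    have /HM : (M <= m.-1)%N by lia.
    by rewrite -(ltr_pM2r b10) mulVf; lra.
  by exists j; [lia|apply: le_lt_trans Hj (HN _ _)].
split; apply: infinite_near0W => d /key[m [m0 Hm bm [j jm jd]]].
  have [t [It t0 Ht]] := isolated_bifurcation_set hb m0 Hm.
  by exists t => //; rewrite t0 (lt_trans (Ht j jm)).
have [t [It t0 Ht]] := isolated_bifurcation_set_plus hb m0 Hm bm.
by exists t => //; rewrite t0 (lt_trans (Ht j jm)).
Qed.

End IsolatedPoints.

(** * Cantor sets near 0 *)

Section LocalCantor.
Context {R : realType}.
Implicit Types (b x y h t e p u v : R) (n m i j k : nat).

Local Notation orb b n x := (iter n (beta_map b) x).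

(** Formally the new point has the first [n] digits of [x] followed by those of [p]. On a common
    branch, the images of [x] and [T^i(1)] are compared; if only [T^i(1)] has digit 1, the image of
    [x] is compared with 1 itself. *)
Lemma follow_lt b p x n i : 1 < b < 2 -> (forall k, p < orb b k 1) ->
  0 <= x < 1 -> x < orb b i 1 -> x + b ^- n * (p - orb b n x) < orb b i 1.
Proof.
move=> hb Hp; case/andP: (hb) => b1 b2; have b0 : 0 < b by lra.
elim: n x i => [|n IH] x i hx xi.
  by rewrite invr1 /= mul1r addrCA subrr addr0.
set q := x + _.
have P01 : 0 <= orb b i 1 <= 1.
  case: i {xi} => [|i]; first by rewrite /= ler01 lexx.
  by rewrite iterS; have := beta_map_itv b (orb b i 1); lra.
have hx1 : 0 <= x <= 1 by lra.
have bq : b * q = b * x + b ^- n * (p - orb b n (beta_map b x)).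
  by rewrite /q mulrDr iterSr exprS invfM mulrA mulrA mulfV ?mul1r //; lra.
have IH' k := IH (beta_map b x) k (beta_map_itv b x).
have iS : orb b i.+1 1 = beta_map b (orb b i 1) by rewrite iterS.
rewrite -(ltr_pM2l b0) bq.
have [[h E]|[h E]] := beta_map_branch hb hx1; have [[h' E']|[h' E']] := beta_map_branch hb P01.
- have := IH' i.+1; rewrite iS E' {1 2}E; have : b * x < b * orb b i 1 by rewrite ltr_pM2l.
  by move=> H /(_ H).
- have := IH' 0%N; rewrite /= {1 2}E => /(_ h); lra.
- have : b * x < b * orb b i 1 by rewrite ltr_pM2l.
  lra.
- have := IH' i.+1; rewrite iS E' {1 2}E; have : b * x < b * orb b i 1 by rewrite ltr_pM2l.
  move=> H; have : b * x - 1 < b * orb b i 1 - 1 by lra.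
  by move=> H2 /(_ H2); lra.
Qed.

(** Redirecting [x] at depth [n] appears at time [j] as redirecting [T^j(x)] at depth [n - j]. *)
Lemma follow_shift b p x n j : 1 < b -> (j <= n)%N ->
  b ^+ j * (b ^- n * (p - orb b n x)) =
  b ^- (n - j) * (p - orb b (n - j) (orb b j x)).
Proof.
move=> b1 jn; rewrite -iterD subnK // mulrA; congr (_ * _).
have bj k : b ^+ k != 0 by rewrite gt_eqF // exprn_gt0; lra.
by rewrite -{1}(subnK jn) exprD invfM mulrC -mulrA mulVf ?mulr1.
Qed.

Lemma plus_limit_point_zero b : 1 < b < 2 -> limit_point (bifurcation_set_plus b) 0.
Proof.
move=> hb; apply: limit_pointW => e e0.
have [p [m [/andP[p0 pe] _ _ Hp]]] := small_periodic hb e0.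
by exists p => //; rewrite subr0 gtr0_norm ?p0.
Qed.

Lemma plus_limit_point b e : 1 < b < 2 -> 0 < e -> (forall i, e <= orb b i 1) ->
  exists2 c : R, 0 < c &
    forall t, t < c -> bifurcation_set_plus b t -> limit_point (bifurcation_set_plus b) t.
Proof.
move=> hb e0 He; case/andP: (hb) => b1 b2; have b0 : 0 < b by lra.
have bgt0 k : 0 < b ^+ k by rewrite exprn_gt0.
have big0 k : 0 < b ^- k by rewrite invr_gt0.
have bile k l : (k <= l)%N -> b ^- l <= b ^- k.
  by move=> kl; rewrite lef_pV2 ?posrE // ler_weXn2l // ltW.
have bnn k : b ^+ k * b ^- k = 1 by rewrite mulfV // gt_eqF.
have [p2 [_ [/andP[p20 p2e] _ _ Ep2]]] := small_periodic hb e0.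
have [p1 [_ [/andP[p10 p12] _ _ Ep1]]] := small_periodic hb p20.
have Hp2 k : p2 < orb b k 1 by have := He k; lra.
have [|M /(_ _ (leqnn M)) HM] := @exprV_small _ b (p2 / 2) b1; first by lra.
(* When the tail is lowered to [p1], [p2 / 2] protects the iterates at least [M] steps before the
   redirection, and [b ^- M * p1] the last ones. *)
exists (Num.min (p2 / 2) (b ^- M * p1)).
  by rewrite lt_min divr_gt0 // mulr_gt0.
move=> t; rewrite lt_min => /andP[tc1 tc2] Et.
case: (Et) => /andP[t0 t1] Ht.
have tp1 : t < p1.
  apply: lt_le_trans tc2 _; rewrite ler_piMl ?(ltW p10) //.
  by have := bile 0%N M (leq0n _); rewrite expr0 invr1.
have [/eqP->|tn0] := boolP (t == 0); first exact: plus_limit_point_zero.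
have tgt0 : 0 < t by rewrite lt_neqAle eq_sym tn0.
apply: limit_pointW => eps eps0.
have o01 k : 0 <= orb b k t < 1 by apply: orb_itv; rewrite t0.
(* Either the orbit of [t] keeps returning below [p2], and at such a time the tail is raised to
   [p2], or it finally stays at or above [p2], and the tail is lowered to [p1]. *)
have [H|] := pselect (forall N, exists2 n, (N <= n)%N & orb b n t < p2).
  have [N HN] := exprV_small b1 eps0.
  have [n Nn Hn] := H N.
  set h := b ^- n * (p2 - orb b n t).
  have h0 : 0 < h by rewrite mulr_gt0 // subr_gt0.
  have hlt : h < eps.
    apply: le_lt_trans (HN n Nn).
    by rewrite /h ler_piMr ?(ltW (big0 _)) //; have := Hp2 0%N; have := o01 n; rewrite /=; lra.
  have hj j : h <= b ^+ j * h by rewrite ler_peMl ?(ltW h0) // exprn_ege1 // ltW.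
  have Hnh : orb b n t + b ^+ n * h = p2 by rewrite /h mulrA bnn; lra.
  exists (t + h); last by rewrite addrAC subrr add0r gtr0_norm ?h0.
  apply: (bifurcation_set_plus_landing (n := n)).
  - have := @follow_lt _ p2 t n 0 hb Hp2; rewrite t0 /= => /(_ t1 t1).
    by rewrite -/h => ->; rewrite andbT addr_ge0 // ltW.
  - move=> j /andP[_ jn]; rewrite lerD //= /h follow_shift //.
    exact: (@follow_lt _ p2 (orb b j t) (n - j) 0 hb Hp2 (o01 j) (orb_lt1 _ _ t1)).
  - move=> i; rewrite Hnh; case: Ep2 => _ /(_ i).
    by have := hj n; have := Ht n; lra.
move=> /existsNP[N HN].
have {}HN n : (N <= n)%N -> p2 <= orb b n t.
  by move=> Nn; rewrite leNgt; apply/negP => ?; apply: HN; exists n.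
(* A periodic [t] would return to [t < p2] forever. So the first iterates keep a gap [mu] above [t],
   which absorbs the negative correction. *)
have Hper j : (0 < j)%N -> t < orb b j t.
  move=> j0; rewrite lt_neqAle Ht andbT; apply/eqP => /esym E.
  have := HN (N * j)%N; rewrite (orb_periodic _ j0 E) modnMl /= => H.
  by have := H (leq_pmulr _ j0); lra.
have [|mu mu0 Hmu] := @finite_pos_lb _ (fun j => orb b j.+1 t - t) N.
  by move=> j _; rewrite subr_gt0; apply: Hper.
have [|K HK] := @exprV_small _ b (Num.min eps mu) b1; first by rewrite lt_min eps0.
set n := (N.+1 + K)%N.
have Nn : (N <= n)%N by rewrite /n ltnW // leq_addr.
have nK j : (j <= N.+1)%N -> (K <= n - j)%N by rewrite /n; clear; lia.
have on : p2 <= orb b n t by apply: HN.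
have on1 := o01 n.
set h := b ^- n * (p1 - orb b n t).
have h0 : h < 0 by rewrite /h pmulr_rlt0 //; lra.
have hj j : (j <= n)%N -> - b ^- (n - j) <= b ^+ j * h <= 0.
  move=> jn; apply/andP; split; last by rewrite mulr_ge0_le0 ?(ltW (bgt0 _)) // ltW.
  have E : b ^+ j * b ^- n = b ^- (n - j).
    by rewrite -{1}(subnK jn) exprD invfM mulrCA mulfV ?mulr1 // gt_eqF.
  rewrite /h mulrA E -mulrN1 ler_wpM2l ?(ltW (big0 _)) //; lra.
have Hnh : orb b n t + b ^+ n * h = p1 by rewrite /h mulrA bnn; lra.
have below x k : 0 <= x <= 1 -> b ^- k * p1 <= x + b ^- k * (p1 - orb b k x).
  move=> hx; have : b ^- k * orb b k x <= b ^- k * (b ^+ k * x).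
    by rewrite ler_wpM2l ?(ltW (big0 _)) // orb_le.
  by rewrite mulrA mulVf ?gt_eqF // mul1r; lra.
exists (t + h); last first.
  rewrite addrAC subrr add0r ltr0_norm // oppr_gt0 h0 /=.
  have := hj 0%N isT; rewrite subn0 mul1r => /andP[h1 _].
  have := HK n; rewrite lt_min => /(_ (leq_addl _ _))/andP[]; lra.
apply: (bifurcation_set_plus_landing (n := n)).
- apply/andP; split; last by lra.
  have := below t n; rewrite -/h t0 (ltW t1) => /(_ isT).
  by apply: le_trans; rewrite mulr_ge0 ?(ltW (big0 _)) ?(ltW p10).
- move=> j /andP[j0 jn]; have /andP[hj1 hj2] := hj j jn.
  apply/andP; split; last by have := o01 j; lra.
  have [jN|Nj] := leqP j N.+1.
    have /Hmu : (j.-1 <= N)%N by rewrite -ltnS prednK.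
    have /HK := nK j jN.
    rewrite lt_min prednK // => /andP[_].
    lra.
  have oj : p2 <= orb b j t by apply/HN/ltnW/ltnW.
  have [h1|h1] := leqP M (n - j).
    by have := bile _ _ h1; lra.
  have -> : b ^+ j * h = b ^- (n - j) * (p1 - orb b (n - j) (orb b j t)).
    by rewrite /h follow_shift.
  have := below (orb b j t) (n - j)%N; have := o01 j.
  have : b ^- M * p1 <= b ^- (n - j) * p1 by rewrite ler_pM2r // bile // ltnW.
  move=> H1 H2 H3.
  have : 0 <= orb b j t <= 1 by apply/andP; split; lra.
  move/H3; lra.
- by move=> i; rewrite Hnh; case: Ep1 => _ /(_ i); lra.
Qed.

(** Without a preimage of 0 in the interval, every [T^n] would be affine of slope [b ^+ n] on it,
    and its image would become longer than 1. *)
Lemma exists_orb_eq0 b u v : 1 < b -> 0 <= u < v -> v <= 1 ->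
  exists x n, u < x < v /\ orb b n x = 0.
Proof.
move=> b1 /andP[u0 uv] v1; apply: contrapT => H.
have b0 : 0 < b by lra.
have {}H x n : u < x < v -> orb b n x != 0.
  by move=> hx; apply/eqP => E; apply: H; exists x, n.
have lin n x y : u < x -> x <= y -> y < v -> orb b n y - orb b n x = b ^+ n * (y - x).
  elim: n x y => [|n IH] x y ux xy yv; first by rewrite mul1r.
  have bn : 0 < b ^+ n.+1 by rewrite exprn_gt0.
  have E := IH x y ux xy yv.
  set ox := orb b n x in E; set oy := orb b n y in E.
  have Eb : b * oy - b * ox = b ^+ n.+1 * (y - x) by rewrite -mulrBr E mulrA exprS.
  have ge0 : 0 <= b ^+ n.+1 * (y - x) by rewrite mulr_ge0 ?(ltW bn) // subr_ge0.
  have le : (Num.floor (b * ox) <= Num.floor (b * oy)) by apply: le_floor; lra.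
  move: le; rewrite le_eqVlt => /orP[/eqP Ef|fxy].
    by rewrite !iterS /beta_map -/ox -/oy Ef -Eb; lra.
  exfalso.
  have fy : (Num.floor (b * oy))%:~R <= b * oy by rewrite floor_le.
  have fx : b * ox < (Num.floor (b * oy))%:~R.
    by apply: lt_le_trans (floorD1_gt _) _; rewrite ler_int lezD1.
  (* If the digits of [x] and [y] differ, [y - d] is the point between them where [T^(n+1)]
     vanishes. *)
  pose d := (b * oy - (Num.floor (b * oy))%:~R) / b ^+ n.+1.
  have d0 : 0 <= d by rewrite divr_ge0 ?subr_ge0 // ltW.
  have bd : b ^+ n.+1 * d = b * oy - (Num.floor (b * oy))%:~R.
    by rewrite /d mulrC divfK // gt_eqF.
  have dxy : d < y - x by rewrite -(ltr_pM2l bn) bd -Eb; lra.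
  have E2 : orb b n y - orb b n (y - d) = b ^+ n * (y - (y - d)) by apply: IH; lra.
  have E3 : b * orb b n (y - d) = (Num.floor (b * oy))%:~R.
    have : b * (oy - orb b n (y - d)) = b ^+ n.+1 * d.
      by rewrite E2 mulrA -exprS; congr (_ * _); lra.
    by rewrite bd; lra.
  have hyd : u < y - d < v by apply/andP; split; lra.
  by have := H _ n.+1 hyd; rewrite iterS /beta_map E3 intrKfloor subrr eqxx.
pose x := u + (v - u) / 3; pose y := v - (v - u) / 3.
have [n /(_ _ (leqnn n)) Hn] := expr_unbounded (y - x)^-1 b1.
have xy : 0 < y - x by rewrite /x /y; lra.
have : 1 < b ^+ n * (y - x) by rewrite -(ltr_pM2r xy) mulVf // in Hn; lra.
have <- : orb b n y - orb b n x = b ^+ n * (y - x) by apply: lin; rewrite /x /y; lra.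
have : 0 <= orb b n x < 1 by apply: orb_itv; rewrite /x; lra.
have : 0 <= orb b n y < 1 by apply: orb_itv; rewrite /y; lra.
by lra.
Qed.

(** Just to the right of a preimage of 0 some iterate is close to 0, hence smaller than the point
    itself; a whole open interval there misses [E_beta^+]. *)
Lemma closure_plus_gap b u v : 1 < b -> 0 <= u < v -> v <= 1 ->
  exists2 y, u < y < v & ~ closure (bifurcation_set_plus b) y.
Proof.
move=> b1 huv v1.
have [x [n [/andP[ux xv] E]]] := exists_orb_eq0 b1 huv v1.
have x0 : 0 < x by lra.
have [|e e0 He] := @orb_right _ b x n b1; first by lra.
have bn : 0 < b ^+ n by rewrite exprn_gt0 //; lra.
pose d := Num.min e (Num.min (v - x) (x / b ^+ n)).
have d0 : 0 < d by rewrite !lt_min e0 subr_gt0 xv divr_gt0.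
have dv : d <= v - x by rewrite /d !ge_min lexx orbT.
exists (x + d / 2); first by apply/andP; split; lra.
move=> /(_ `]x, x + d[%classic).
have N : nbhs (x + d / 2) `]x, x + d[%classic.
  by apply: near_in_itvoo; rewrite in_itv /=; apply/andP; split; lra.
move=> /(_ N)[z [[z01 Hz]]]; rewrite /= in_itv /= => /andP[xz zd].
have := Hz n; have -> : z = x + (z - x) by lra.
rewrite He //; last first.
  have : d <= e by rewrite /d ge_min lexx.
  by move=> ?; apply/andP; split; lra.
have : d <= x / b ^+ n by rewrite /d !ge_min lexx !orbT.
rewrite ler_pdivlMr // E add0r => H1.
have : b ^+ n * (z - x) < b ^+ n * d by rewrite ltr_pM2l //; lra.
by lra.
Qed.

Lemma cantor_near0 b e : 1 < b < 2 -> 0 < e -> (forall i, e <= orb b i 1) ->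
  exists2 d : R, 0 < d & cantor_set (closure (bifurcation_set_plus b) `&` `[0, d]).
Proof.
move=> hb e0 He; case/andP: (hb) => b1 b2.
have [c c0 Hc] := plus_limit_point hb e0 He.
(* The cut [d] is taken outside the closure, so intersecting with [[0, d]] creates no isolated end
   point. *)
have [||d /andP[d0 dc] Hd] := @closure_plus_gap b 0 (Num.min c 1) b1.
- by rewrite lexx lt_min c0 /=.
- by rewrite ge_min lexx orbT.
move: dc; rewrite lt_min => /andP[dc d1].
exists d => //.
set E := bifurcation_set_plus b.
set A := closure E `&` `[0, d].
have clA : closed A by apply: closedI; [exact: closed_closure|exact: interval_closed].
have A0 : A 0.
  split; last by rewrite /= in_itv /= lexx ltW.
  apply: subset_closure; split=> [|n]; first by rewrite lexx ltr01.
  by rewrite orb0.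
split.
- by exists 0.
- by apply: subclosed_compact clA (@segment_compact _ 0 d) _ => x [].
- split=> //; apply/seteqP; split=> x.
    by move=> Hx; apply: clA; rewrite closure_limit_point; right.
  move=> [Ex]; rewrite /= in_itv /= => /andP[x0]; rewrite le_eqVlt => /orP[/eqP xd|xd].
    by rewrite xd in Ex.
  have W U : nbhs x U -> nbhs x (U `&` `]-oo, d[%classic).
    by move=> HU; apply: filterI => //; exact: lt_nbhsl.
  have inA y U : E y -> (U `&` `]-oo, d[%classic) y -> A y /\ U y.
    move=> Ey [Uy]; rewrite /= in_itv /= => yd; split=> //; split.
      exact: subset_closure.
    by rewrite /= in_itv /=; case: Ey => /andP[-> _] _; rewrite ltW.
  move=> U /W HU.
  have [xE|xE] := pselect (E x).
    have [y [yx Ey Uy]] := Hc x (lt_trans xd dc) xE _ HU.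
    by have [Ay Uy'] := inA _ _ Ey Uy; exists y.
  have [y [Ey Uy]] := Ex _ HU.
  have [Ay Uy'] := inA _ _ Ey Uy; exists y; split=> //.
  by apply/eqP => yx; rewrite yx in Ey.
- move=> x Ax; apply/seteqP; split=> [y|y ->]; last exact: connected_component_refl.
  move=> [C [Cx CA /connected_intervalP Ci] Cy].
  suff gap u v : C u -> C v -> ~ (u < v).
    by have [h|h|//] := ltgtP y x; [case: (gap y x)|case: (gap x y)].
  move=> Cu Cv uv.
  have /CA[_] := Cu; rewrite /= in_itv /= => /andP[u0 _].
  have /CA[_] := Cv; rewrite /= in_itv /= => /andP[_ vd].
  have [||w /andP[uw wv] Hw] := @closure_plus_gap b u v b1; [by rewrite u0|by lra|].
  by apply: Hw; have /CA[] : C w by apply: (Ci u v) => //; rewrite !ltW.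
Qed.

End LocalCantor.

(** * Almost every parameter *)

Section DigitExpansions.
Context {R : realType}.
Implicit Types (b x y l : R) (d : nat -> int) (n i j k : nat).

Local Notation orb b n x := (iter n (beta_map b) x).

(* This is T^n(1) in base x when d lists the digits of the expansion of 1 in that base. *)
Fixpoint remainder d x n : R :=
  if n is n'.+1 then x * remainder d x n' - (d n')%:~R else 1.

Definition digit b n : int := Num.floor (b * orb b n 1).

Lemma remainder_digit b n : remainder (digit b) b n = orb b n 1.
Proof. by elim: n => //= n ->. Qed.

Lemma remainder_orb d x n : (forall j, (0 < j <= n)%N -> 0 <= remainder d x j < 1) ->
  forall j, (j <= n)%N -> orb x j 1 = remainder d x j.
Proof.
move=> H; elim=> [//|j IH] jn; rewrite iterS IH; last lia.
apply: (@beta_map_eq _ _ _ _ (d j)); first by apply: H; rewrite jn.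
by rewrite /= subrK.
Qed.

Lemma remainder_mono d l x n : 0 <= l <= x -> (forall j, (j <= n)%N -> 0 <= remainder d l j) ->
  forall j, (j <= n)%N -> remainder d l j <= remainder d x j.
Proof.
move=> /andP[l0 lx] H; elim=> [//|j IH] jn /=; rewrite lerD2r ler_pM //; [|apply: IH; lia].
by apply: H; lia.
Qed.

(** At each step the difference is multiplied by [l] and gains the nonnegative term
    [(x - l) * remainder d x j]. This replaces a lower bound on the derivative in the parameter. *)
Lemma remainder_expand d l x n : 0 <= l <= x -> (forall j, (j <= n)%N -> 0 <= remainder d l j) ->
  forall i j, (j + i <= n)%N ->
    l ^+ i * (remainder d x j - remainder d l j) <= remainder d x (j + i) - remainder d l (j + i).
Proof.
move=> lx H i j; elim: i => [|i IH] jn; first by rewrite addn0 mul1r.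
have /IH{}IH : (j + i <= n)%N by lia.
have ji : (j + i <= n)%N by lia.
have h1 := remainder_mono lx H ji; have h2 := H _ ji.
rewrite addnS exprS /=; case/andP: lx => l0 lx.
have : l * (l ^+ i * (remainder d x j - remainder d l j)) <=
  l * (remainder d x (j + i) - remainder d l (j + i)) by rewrite ler_wpM2l.
have : 0 <= (x - l) * remainder d x (j + i).
  by rewrite mulr_ge0 ?subr_ge0 //; apply: le_trans h1.
by lra.
Qed.

(** In the induction, the chord of the products exceeds the product with the chord by
    [s * (1 - s) * (y - l) * (Q - P)], which is nonnegative by monotonicity. *)
Lemma remainder_convex d l x y s n : 0 <= l -> 0 <= s <= 1 -> l <= y -> x = l + s * (y - l) ->
  (forall j, (j <= n)%N -> 0 <= remainder d l j) ->
  forall j, (j <= n)%N -> remainder d x j <= (1 - s) * remainder d l j + s * remainder d y j.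
Proof.
move=> l0 /andP[s0 s1] ly Ex H; elim=> [|j IH] jn /=; first by lra.
have jn' : (j <= n)%N by lia.
have {}IH := IH jn'.
have h := @remainder_mono d l y n _ H j jn'; rewrite l0 ly in h; have {}h := h isT.
have hl := H j jn'.
set P := remainder d l j in IH h hl *; set Q := remainder d y j in IH h *.
have sl : 0 <= s * (y - l) by rewrite mulr_ge0 // subr_ge0.
have : x * remainder d x j <= x * ((1 - s) * P + s * Q) by rewrite ler_wpM2l // Ex; lra.
have : 0 <= (s * (1 - s)) * ((y - l) * (Q - P)).
  by rewrite !mulr_ge0 // ?subr_ge0.
by rewrite Ex; lra.
Qed.

Lemma remainder_continuous d n : continuous (fun x => remainder d x n).
Proof.
elim: n => [|n IH] x /=; first exact: cvg_cst.
by apply: cvgB; [apply: cvgM; [exact: cvg_id|exact: IH]|exact: cvg_cst].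
Qed.

End DigitExpansions.

(** * Halving times for almost every parameter *)

Section AlmostEvery.
Context {R : realType}.
Implicit Types (b x y l c e : R) (n m i j k : nat).

Local Notation orb b n x := (iter n (beta_map b) x).
Local Notation mu := (@lebesgue_measure R).

Lemma orb1_itv b n : (0 < n)%N -> 0 <= orb b n 1 < 1.
Proof. by case: n => // n _; rewrite iterS beta_map_itv. Qed.

Lemma orb1_01 b n : 0 <= orb b n 1 <= 1.
Proof. by case: n => [|n]; [rewrite /= ler01 lexx|have := @orb1_itv b n.+1 isT; lra]. Qed.

Lemma digit01 b n : 1 < b < 2 -> digit b n = 0 \/ digit b n = 1.
Proof. by move=> hb; apply: floor01 hb (orb1_01 b n). Qed.

Lemma digit_ge0 b n : 1 < b < 2 -> 0 <= (digit b n)%:~R :> R.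
Proof. by move=> /(@digit01 _ n)[->|->]. Qed.

Lemma digit0 b : 1 < b < 2 -> digit b 0 = 1.
Proof. by move=> hb; apply: floor_def; rewrite /= mulr1; apply/andP; split; lra. Qed.

Lemma remainder_back d l n : 0 < l -> (forall k, 0 <= (d k)%:~R :> R) -> 0 <= remainder d l n ->
  forall j, (j <= n)%N -> 0 <= remainder d l j.
Proof.
move=> l0 d0; elim: n => [|n IH] Hn j; first by rewrite leqn0 => /eqP->.
rewrite leq_eqVlt => /orP[/eqP->//|]; rewrite ltnS; apply: IH.
by have := Hn; rewrite /= subr_ge0 => h; rewrite -(pmulr_rge0 _ l0) (le_trans (d0 n)).
Qed.

(* Left of b lies an interval ]l, b[ of parameters with the same first n digits, on which the
   n-th iterate of 1 increases convexly from 0; where it is small, n is a halving time. *)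
Lemma halving_times_nearby b n c e : 1 < b < 2 -> (0 < n)%N -> digit b n.-1 = 1 ->
  (forall j, (j <= n)%N -> e <= orb b j 1) -> 0 < e -> 0 < c <= 1 -> c * orb b n 1 <= e ->
  exists l, [/\ 1 <= l < b,
    forall x, l < x <= l + c / 4 * (b - l) -> halving_time x n &
    forall a, 1 < a < b -> 1 < a ^+ n.-1 * (b - a) -> a ^+ n.-1 * (b - l) <= 1].
Proof.
move=> hb n0 dn He e0 /andP[c0 c1] ce; case/andP: (hb) => b1 b2.
set d := digit b.
have d0 k : 0 <= (d k)%:~R :> R by apply: digit_ge0.
have Pb j : remainder d b j = orb b j 1 by apply: remainder_digit.
have d00 : d 0 = 1 by apply: digit0.
rewrite -/d in dn; clearbody d.
have Pn : 0 < orb b n 1 by apply: lt_le_trans e0 (He n (leqnn n)).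
(* At the parameter 1 the remainders are nonpositive, so the intermediate value theorem yields the
   zero [l]. *)
have Q1 j : (0 < j)%N -> remainder d (1 : R) j <= 0.
  elim: j => // -[_ _|j IH _] /=; first by rewrite d00 // mulr1 subrr.
  by have := IH isT; rewrite /= !mul1r; have := d0 j.+1; lra.
have [l] : exists2 l, l \in `[1, b] & remainder d l n = 0.
  apply: IVT; first by rewrite ltW.
    by apply: continuous_subspaceT => x; exact: remainder_continuous.
  by rewrite ge_min Q1 //= le_max Pb (ltW Pn) orbT.
rewrite in_itv /= => /andP[l1 lb] Eln.
have {}lb : l < b.
  by rewrite lt_neqAle lb andbT; apply/eqP => E; move: Eln; rewrite E Pb; lra.
have l0 : 0 < l by lra.
have Ql : forall j, (j <= n)%N -> 0 <= remainder d l j.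
  by apply: remainder_back => //; rewrite Eln.
have lb' : 0 <= l <= b by lra.
have ln1 : remainder d l n.-1 = l^-1.
  have : l * remainder d l n.-1 = 1.
    move: Eln; rewrite -{1}(prednK n0) /= dn; lra.
  by move=> h; apply: (mulfI (lt0r_neq0 l0)); rewrite h mulfV // lt0r_neq0.
(* The digit 1 just before the zero gives [l^-1], and each step back divides by [l] at worst. *)
have Qlk k : (k.+1 <= n)%N -> l ^- k.+1 <= remainder d l (n - k.+1).
  elim: k => [|k IH] kn; first by rewrite subn1 ln1 expr1.
  have {}IH := IH (ltnW kn).
  rewrite exprS invfM -(ler_pM2l l0) mulrA mulfV ?lt0r_neq0 // mul1r.
  apply: le_trans IH _; rewrite -(subnSK kn) /=.
  by have := d0 (n - k.+2)%N; lra.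
(* From [l] to [b] the [j]-th remainder grows by at most [l ^- (n - j)], hence at most doubles. *)
have Ql2 j : (j < n)%N -> e <= 2 * remainder d l j.
  move=> jn; have h1 := Qlk (n - j).-1; rewrite prednK ?subn_gt0 // subKn ?(ltnW jn) // in h1.
  have {}h1 := h1 (leq_subr _ _).
  have h2 := @remainder_expand _ d l b n lb' Ql (n - j) j; rewrite subnKC ?(ltnW jn) // in h2.
  have {}h2 := h2 (leqnn n); rewrite Eln !Pb subr0 in h2.
  have h3 : 0 < l ^+ (n - j) by rewrite exprn_gt0.
  have h4 : orb b j 1 - remainder d l j <= l ^- (n - j).
    rewrite -(ler_pM2l h3) mulfV ?lt0r_neq0 //; apply: le_trans h2 _.
    by have := @orb1_itv b n n0; lra.
  by have := He j (ltnW jn); lra.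
exists l; split; first by rewrite l1 lb.
  move=> x /andP[lx xc].
  have s4 : 0 <= c / 4 <= 1 by lra.
  have bl : c / 4 * (b - l) <= 1 * (b - l) by rewrite ler_pM2r; lra.
  have xb : 0 <= x <= b by lra.
  have lx' : 0 <= l <= x by lra.
  have Hl j : (j <= n)%N -> remainder d l j <= remainder d x j by apply: remainder_mono.
  have Qx j : (j <= n)%N -> 0 <= remainder d x j.
    by move=> jn; apply: le_trans (Ql j jn) (Hl j jn).
  have Hx : forall j, (j <= n)%N -> orb x j 1 = remainder d x j.
    apply: remainder_orb => j /andP[j0 jn]; rewrite Qx //=.
    apply: le_lt_trans (remainder_mono xb Qx jn) _.
    by rewrite Pb; case/andP: (orb1_itv b j0).
  rewrite /halving_time Hx //.
  have xn : remainder d x n <= e / 4.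
    pose s := (x - l) / (b - l).
    have bl0 : 0 < b - l by lra.
    have sE : s * (b - l) = x - l by rewrite /s divfK // lt0r_neq0.
    have s0 : 0 <= s by rewrite divr_ge0 //; lra.
    have sc : s <= c / 4 by rewrite /s ler_pdivrMr //; lra.
    have := @remainder_convex _ d l x b s n _ _ _ _ Ql n (leqnn n).
    rewrite Eln mulr0 add0r Pb sE => H.
    have {}H : remainder d x n <= s * orb b n 1 by apply: H; lra.
    have : s * orb b n 1 <= c / 4 * orb b n 1 by rewrite ler_pM2r.
    lra.
  split.
    have := @remainder_expand _ d l x n lx' Ql n.-1 1%N; rewrite add1n prednK // => /(_ (leqnn n)).
    rewrite Eln /= !mulr1 subr0; apply: lt_le_trans.
    by rewrite mulr_gt0 ?exprn_gt0 //; lra.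
  move=> j jn; rewrite Hx ?(ltnW jn) //.
  by have := Ql2 j jn; have := Hl j (ltnW jn); lra.
move=> a /andP[a1 ab] Ha.
(* The left side is bounded by the growth of the [n]-th remainder from [y] to [b]. So an [a]
   violating it lies left of [l], which makes [b - l] at most [a ^- n.-1]. *)
have gap y : l <= y -> y <= b -> y ^+ n.-1 * (b - y) < 1.
  move=> ly yb.
  have ly' : 0 <= l <= y by lra.
  have yb' : 0 <= y <= b by lra.
  have Qy j : (j <= n)%N -> 0 <= remainder d y j.
    by move=> jn; apply: le_trans (Ql j jn) (remainder_mono ly' Ql jn).
  have := @remainder_expand _ d y b n yb' Qy n.-1 1%N; rewrite add1n prednK // => /(_ (leqnn n)).
  rewrite (Pb n) /= !mulr1 => H; have := Qy n (leqnn n); have /andP[_] := orb1_itv b n0.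
  move: H; have -> : b - (d 0%N)%:~R - (y - (d 0%N)%:~R) = b - y by lra.
  lra.
have al : a <= l.
  by rewrite leNgt; apply/negP => la; have := gap a (ltW la) (ltW ab); lra.
apply/ltW/(le_lt_trans _ (gap l (lexx l) (ltW lb))).
rewrite ler_pM2r ?subr_gt0 // lerXn2r // nnegrE; lra.
Qed.

(** If the orbit of 1 is bounded below by [e], any [n] just after a digit 1 works with [c = e], and
    such digits recur because the orbit cannot grow forever. Otherwise [n] is a record minimum,
    preceded by a digit 1 since a digit 0 would mean growth. *)
Lemma frequent_small_remainders b : 1 < b < 2 -> (forall n, 0 < orb b n 1) ->
  exists2 c : R, 0 < c <= 1 & forall N, exists n e,
    [/\ (N < n)%N, digit b n.-1 = 1, 0 < e, forall j, (j <= n)%N -> e <= orb b j 1 &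
        c * orb b n 1 <= e].
Proof.
move=> hb P0; case/andP: (hb) => b1 b2.
have step n : orb b n.+1 1 = b * orb b n 1 - (digit b n)%:~R by [].
have [[e e0 He]|H] := pselect (exists2 e : R, 0 < e & forall n, e <= orb b n 1).
  exists e; first by rewrite e0; have := He 0%N.
  move=> N; apply: contrapT => H.
  have D n : (N <= n)%N -> digit b n = 0.
    move=> Nn; have [//|d1] := digit01 n hb; case: H; exists n.+1, e; split=> //.
    by rewrite ler_piMr ?(ltW e0) //; have := orb1_01 b n.+1; lra.
  have G k : orb b (N + k) 1 = b ^+ k * orb b N 1.
    elim: k => [|k IH]; first by rewrite addn0 mul1r.
    by rewrite addnS step D ?leq_addr // IH subr0 exprS mulrA.
  have [k /(_ _ (leqnn k)) Hk] := expr_unbounded (orb b N 1)^-1 b1.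
  have := orb1_01 b (N + k); rewrite G.
  by move: Hk; rewrite -(ltr_pM2r (P0 N)) mulVf ?lt0r_neq0 //; lra.
exists 1; first by rewrite ltr01 lexx.
move=> N.
have [j _|e e0 He] := @finite_pos_lb _ (fun j => orb b j 1) N; first exact: P0.
have ex : exists n, orb b n 1 < e.
  apply: contrapT => H'; apply: H; exists e => // n.
  by rewrite leNgt; apply/negP => h; apply: H'; exists n.
have [n Hn Hmin] := @ex_minnP (fun n => orb b n 1 < e) ex.
have Nn : (N < n)%N by rewrite ltnNge; apply/negP => /He; lra.
have rec j : (j <= n)%N -> orb b n 1 <= orb b j 1.
  rewrite leq_eqVlt => /orP[/eqP->//|jn].
  have : ~~ (orb b j 1 < e) by apply/negP => /Hmin; rewrite leqNgt jn.
  by rewrite -leNgt; lra.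
exists n, (orb b n 1); split=> //; last by rewrite mul1r.
have n0 : (0 < n)%N by lia.
have [d0|//] := digit01 n.-1 hb.
exfalso; have := step n.-1; rewrite prednK // d0 subr0 => E.
have := rec n.-1 (leq_pred n); rewrite E.
have : 0 < (b - 1) * orb b n.-1 1 by rewrite mulr_gt0 ?subr_gt0.
lra.
Qed.

(** Parameters whose orbit of 1 reaches 0 are left out; they are countable and treated
    separately. *)
Definition no_halving_from m : set R :=
  [set b | 1 < b < 2 /\ (forall n, 0 < orb b n 1) /\
           forall n, (m <= n)%N -> exists2 j, (j < n)%N & orb b j 1 < 2 * orb b n 1].

Lemma measurable_orb1 n : measurable_fun setT (fun b => orb b n 1).
Proof.
elim: n => [|n IH]; first exact: measurable_cst.
have mM : measurable_fun setT (fun b => b * orb b n 1) by apply: measurable_funM.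
apply: measurable_funB => //.
apply: (@measurableT_comp _ _ _ _ _ _ (fun y : R => (Num.floor y)%:~R : R) _ _ _ mM).
apply: nondecreasing_measurable => // x y xy.
by rewrite ler_int; exact: le_floor.
Qed.

Lemma measurable_set_lt (f g : R -> R) : measurable_fun setT f -> measurable_fun setT g ->
  measurable [set x | f x < g x].
Proof.
move=> mf mg.
have -> : [set x | f x < g x] = setT `&` (g \- f) @^-1` `]0, +oo[.
  by apply/seteqP; split=> x /=; rewrite in_itv /= andbT subr_gt0 //; case.
exact: (measurable_funB mg mf).
Qed.

Lemma measurable_no_halving_from m : measurable (no_halving_from m).
Proof.
have -> : no_halving_from m = `]1, 2[ `&` ((\bigcap_n [set b | 0 < orb b n 1]) `&`
   (\bigcap_(n in [set n | (m <= n)%N])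
      \bigcup_(j in [set j | (j < n)%N]) [set b | orb b j 1 < 2 * orb b n 1])).
  apply/seteqP; split=> b /=.
    move=> [hb [P0 H]]; split; first by rewrite in_itv.
    split=> n /= mn; first exact: P0.
    by have [j jn Hj] := H n mn; exists j.
  rewrite in_itv /= => -[hb [P0 H]]; split=> //; split; first by move=> n; exact: P0.
  by move=> n mn; have [j jn Hj] := H n mn; exists j.
apply: measurableI; first exact: measurable_itv.
apply: measurableI.
  apply: bigcap_measurable; first by exists 0%N.
  by move=> n _; apply: measurable_set_lt; [exact: measurable_cst|exact: measurable_orb1].
apply: bigcap_measurable; first by exists m => /=.
move=> n _; apply: bigcup_measurable => j _.
apply: measurable_set_lt; first exact: measurable_orb1.
by apply: measurable_funM; [exact: measurable_cst|exact: measurable_orb1].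
Qed.

(* A density point b of the set would see the interval just right of l as a fixed proportion
   of the ball of radius b - l. *)
Lemma no_halving_from_negligible m : mu.-negligible (no_halving_from m).
Proof.
have := lebesgue_density (measurable_no_halving_from m).
apply: negligibleS => b Bb /= Hcvg.
have [hb [P0 _]] := Bb; case/andP: (hb) => b1 b2.
have [c c01 Hc] := frequent_small_remainders hb P0.
move: Hcvg; rewrite indicE mem_set //= => Hcvg.
(* The excluded interval has length [c / 4 * r] in a ball of length [2 * r], hence [c / 8]. *)
have {Hcvg} : \forall r \near 0^'+,
    ((1 - c / 8)%:E < mu (no_halving_from m `&` ball b r) * (mu (ball b r))^-1)%E.
  apply: (Hcvg [set y : \bar R | ((1 - c / 8)%:E < y)%E]); apply: open_nbhs_nbhs; split; first exact: open_ereal_gt_ereal.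
  by rewrite /= lte_fin; lra.
move=> /nbhs_ballP[d /= d0 Hd].
(* A fixed [a] between 1 and [b] makes [b - l <= a ^- n.-1] for large [n], so the balls shrink. *)
pose a := (1 + b) / 2.
have a1 : 1 < a by rewrite /a; lra.
have ab : a < b by rewrite /a; lra.
have [N1 HN1] := expr_unbounded (b - a)^-1 a1.
have [N2 HN2] := exprV_small a1 d0.
have [n [e [Nn dn e0 He ce]]] := Hc (maxn m (maxn N1 N2)).+1.
have [n0 mn N1n N2n] : [/\ (0 < n)%N, (m <= n)%N, (N1 <= n.-1)%N & (N2 <= n.-1)%N].
  by move: Nn; clear; split; lia.
have [l [/andP[l1 lb] Hl Hal]] := halving_times_nearby hb n0 dn He e0 c01 ce.
have an0 : 0 < a ^+ n.-1 by rewrite exprn_gt0 //; lra.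
have {}Hal : b - l < d.
  apply: le_lt_trans (HN2 _ N2n); rewrite -(ler_pM2l an0) mulfV ?lt0r_neq0 //.
  apply: Hal; first by rewrite a1.
  have ab0 : 0 < b - a by rewrite subr_gt0.
  by have h := HN1 _ N1n; rewrite -(ltr_pM2r ab0) mulVf ?lt0r_neq0 // in h.
have r0 : 0 < b - l by rewrite subr_gt0.
have := Hd (b - l); rewrite /ball /= sub0r normrN gtr0_norm // => /(_ Hal r0).
rewrite -/(ball _ _) lebesgue_measure_ball ?(ltW r0) // inver mulrn_eq0 /= gt_eqF //.
rewrite lte_pdivlMr ?mulrn_wgt0 //; apply/negP; rewrite -leNgt.
have H : no_halving_from m `&` ball b (b - l) `<=` `](l + c / 4 * (b - l)), (b + (b - l))[.
  move=> x [[_ [_ Bx]]]; rewrite ball_itv /= !in_itv /= => /andP[x1 x2].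
  rewrite x2 andbT ltNge; apply/negP => xl.
  have [_ hx] : halving_time x n by apply: Hl; apply/andP; split; lra.
  by have [j jn] := Bx n mn; have := hx j jn; lra.
have : (mu (no_halving_from m `&` ball b (b - l)%R) <=
        mu `](l + c / 4 * (b - l))%R, (b + (b - l))%R[)%E.
  apply: le_measure; rewrite ?inE //.
  by apply: measurableI; [exact: measurable_no_halving_from|exact: measurable_ball].
move/le_trans; apply.
have cr : c * (b - l) <= b - l by rewrite ler_piMl ?(ltW r0) //; lra.
rewrite lebesgue_measure_itv /= lte_fin ifT; last by lra.
by rewrite -EFinD -EFinM lee_fin; lra.
Qed.

(** For fixed first [n] digits the [n]-th remainder is strictly increasing in the parameter, so it
    vanishes for at most one. *)
Lemma countable_orb1_eq0 : countable [set b : R | 1 < b < 2 /\ exists n, orb b n 1 = 0].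
Proof.
have -> : [set b : R | 1 < b < 2 /\ exists n, orb b n 1 = 0] =
    \bigcup_n [set b : R | 1 < b < 2 /\ orb b n 1 = 0].
  by apply/seteqP; split=> b /= => [[hb [n E]]|[n _ [hb E]]]; [exists n|split=> //; exists n].
apply: bigcup_countable => // n _; apply/countable_injP.
exists (fun b => pickle (mkseq (digit b) n)).
suff wlog_ (b b' : R) : 1 < b < 2 -> 1 < b' < 2 -> orb b n 1 = 0 -> orb b' n 1 = 0 ->
    mkseq (digit b) n = mkseq (digit b') n -> ~ (b < b').
  move=> b b' /set_mem[hb E] /set_mem[hb' E'] /(pcan_inj pickleK) Es.
  by have [h|h|//] := ltgtP b b'; [case: (wlog_ b b')|case: (wlog_ b' b)].
move=> hb hb' E E' Es bb'.
case: n E E' Es => [|n] E E' Es; first by move: E => /=; lra.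
have dE j : (j < n.+1)%N -> digit b j = digit b' j.
  by move=> jn; rewrite -(nth_mkseq 0 (digit b) jn) Es nth_mkseq.
have rE j : (j <= n.+1)%N -> remainder (digit b) b' j = orb b' j 1.
  by elim: j => [//|j IH] jn /=; rewrite IH ?(ltnW jn) // dE.
have b0 : 0 <= b <= b' by lra.
have H j : (j <= n.+1)%N -> 0 <= remainder (digit b) b j.
  by move=> _; rewrite remainder_digit; have := orb1_01 b j; lra.
have := @remainder_expand _ (digit b) b b' n.+1 b0 H n 1%N; rewrite add1n => /(_ (leqnn _)).
rewrite (rE n.+1) // (remainder_digit b n.+1) E E' /= !mulr1 subr0 leNgt => /negP[].
by rewrite mulr_gt0 ?exprn_gt0 //; lra.
Qed.

Lemma ae_halving : {ae mu, forall b : R, 1 < b < 2 ->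
  forall n, exists2 m, (n <= m)%N & halving_time b m}.
Proof.
have : mu.-negligible ((\bigcup_m no_halving_from m) `|`
    [set b : R | 1 < b < 2 /\ exists n, orb b n 1 = 0]).
  apply: negligibleU; first by apply: negligible_bigcup => m; exact: no_halving_from_negligible.
  apply/negligibleP; last exact/countable_lebesgue_measure0/countable_orb1_eq0.
  exact/countable_measurable/countable_orb1_eq0.
apply: negligibleS => b /= /not_implyP[hb /existsNP[m Hm]].
have [h|h] := pselect (exists n, orb b n 1 = 0); first by right.
left; exists m => //; split=> //; split.
  move=> n; rewrite lt_neqAle; have := orb1_01 b n => /andP[-> _]; rewrite andbT eq_sym.
  by apply/eqP => E; apply: h; exists n.
move=> n mn; apply: contrapT => H; apply: Hm; exists n => //; split.
  rewrite lt_neqAle; have := orb1_01 b n => /andP[-> _]; rewrite andbT eq_sym.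
  by apply/eqP => E; apply: h; exists n.
by move=> j jn; rewrite leNgt; apply/negP => hj; apply: H; exists j.
Qed.

End AlmostEvery.

(** * Parameters with prescribed expansions *)

Section PrescribedExpansions.
Context {R : realType}.
Implicit Types (b x y e : R) (d : nat -> int) (n m i j k : nat).

Local Notation orb b n x := (iter n (beta_map b) x).

Lemma remainder_neg d x j i : 0 < x -> (forall k, 0 <= (d k)%:~R :> R) ->
  remainder d x j < 0 -> remainder d x (j + i) < 0.
Proof.
move=> x0 d0 H; elim: i => [|i IH]; first by rewrite addn0.
rewrite addnS /=; have := d0 (j + i)%N.
have : x * remainder d x (j + i) < 0 by rewrite pmulr_rlt0.
lra.
Qed.

Lemma near_remainder d b (P : set R) n : open P -> P (remainder d b n) ->
  exists2 e : R, 0 < e & forall x, `|b - x| < e -> P (remainder d x n).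
Proof.
move=> oP Pb; have : nbhs (remainder d b n) P by apply: open_nbhs_nbhs.
move=> /(@remainder_continuous R d n b) /nbhs_ballP[e /= e0 He].
by exists e => // x bx; apply: He.
Qed.

(* b is the supremum of the x for which some remainder is negative. *)
Lemma expansion_exists d : (forall k, d k = 0 \/ d k = 1) -> d 0%N = 1 -> d 1%N = 1 ->
  (exists k, d k = 0) ->
  exists b, 3 / 2 <= b < 2 /\ forall j, 0 <= remainder d b j <= (b - 1)^-1.
Proof.
move=> d01 d00 d11 [k0 dk0].
have dR k : 0 <= ((d k)%:~R : R) <= 1 by case: (d01 k) => ->; rewrite ?lexx ler01.
have dge0 k : 0 <= (d k)%:~R :> R by case/andP: (dR k).
pose S : set R := [set x | 1 <= x <= 2 /\ exists j, remainder d x j < 0].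
have S32 : S (3 / 2).
  split; first by apply/andP; split; lra.
  by exists 2%N; rewrite /= d00 d11; lra.
have ubS : ubound S 2 by move=> x [/andP[]].
have supS : has_sup S by split; [exists (3 / 2)|exists 2].
pose b := sup S.
have b32 : 3 / 2 <= b by apply: ub_le_sup => //; exists 2.
have b2 : b <= 2 by apply: ge_sup => //; exists (3 / 2).
have r2 j : 1 <= remainder d (2 : R) j.
  by elim: j => [|j IH] /=; [rewrite lexx|have := dR j; lra].
have ge0 j : 0 <= remainder d b j.
  rewrite leNgt; apply/negP => H.
  have [e e0 He] := @near_remainder d b [set y | y < 0] j (@open_lt R 0) H.
  have [b2'|b2'] := ltP b 2; last first.
    have E : b = 2 by apply/eqP; rewrite eq_le b2.
    by have := r2 j; rewrite -E; lra.
  pose h := Num.min (e / 2) (2 - b).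
  have h0 : 0 < h by rewrite lt_min; lra.
  have he : h <= e / 2 by rewrite /h ge_min lexx.
  have h2 : h <= 2 - b by rewrite /h ge_min lexx orbT.
  have Sbh : S (b + h).
    split; first by apply/andP; split; lra.
    exists j; apply: He; rewrite opprD addrA subrr add0r normrN gtr0_norm //; lra.
  have : b + h <= b by apply: ub_le_sup => //; exists 2.
  lra.
(* A remainder above [(b - 1)^-1] would exceed [(x - 1)^-1] for some [x] of [S] close to [b] too,
   and stay above it, contradicting that a remainder at [x] becomes negative for good. *)
have le1 j : remainder d b j <= (b - 1)^-1.
  have b10 : 0 < b - 1 by lra.
  rewrite -(ler_pM2l b10) mulfV ?lt0r_neq0 // leNgt; apply/negP => H.
  have [e e0 He] : exists2 e : R, 0 < e &
      forall x, `|b - x| < e -> 1 < (x - 1) * remainder d x j.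
    have : nbhs ((b - 1) * remainder d b j) [set y | 1 < y].
      by apply: open_nbhs_nbhs; split => //; exact: open_gt.
    have : {for b, continuous (fun x => (x - 1) * remainder d x j)}.
      apply: continuousM; last exact: remainder_continuous.
      by apply: continuousB; [exact: cvg_id|exact: cvg_cst].
    move=> /[apply] /nbhs_ballP[e /= e0 He].
    by exists e => // x bx; apply: He.
  have e40 : 0 < Num.min e (1 / 4) by rewrite lt_min e0; lra.
  have [x Sx xb] := sup_adherent e40 supS.
  have xleb : x <= b by apply: ub_le_sup => //; exists 2.
  rewrite -/b in xb.
  have m1 : Num.min e (1 / 4) <= e by rewrite ge_min lexx.
  have m2 : Num.min e (1 / 4) <= 1 / 4 by rewrite ge_min lexx orbT.
  have Hx : 1 < (x - 1) * remainder d x j.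
    by apply: He; rewrite ger0_norm ?subr_ge0 //; lra.
  have x1 : 1 < x by lra.
  case: Sx => _ [i Hi].
  have P k : 1 < (x - 1) * remainder d x (j + k).
    elim: k => [|k IH]; first by rewrite addn0.
    rewrite addnS /=; have := dR (j + k)%N.
    have h1 : x < x * ((x - 1) * remainder d x (j + k)) by rewrite ltr_pMr //; lra.
    move=> /andP[_ h2].
    have : (x - 1) * (d (j + k)%N)%:~R <= (x - 1) by rewrite ler_piMr //; lra.
    lra.
  have x0 : 0 < x by lra.
  have := remainder_neg j x0 dge0 Hi; rewrite addnC => h1.
  have : (x - 1) * remainder d x (j + i) < 0 by rewrite pmulr_rlt0 //; lra.
  by have := P i; lra.
exists b; split; last by move=> j; rewrite ge0 le1.
(* At [b = 2] the upper bound is 1, but all remainders are at least 1 and a digit 0 doubles one. *)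
rewrite b32 /= lt_neqAle b2 andbT; apply/eqP => E.
have := le1 k0.+1; rewrite E /= dk0; have := r2 k0.
have -> : (2 - 1 : R) = 1 by lra.
by rewrite invr1; lra.
Qed.

(** Applied both to the remainders and to their distances to [(b - 1)^-1], which obey the same
    recursion with complementary digits. *)
Lemma backward_ge (u c : nat -> R) b n j r : 1 < b -> (forall k, 0 <= u k) -> (forall k, 0 <= c k) ->
  (forall k, b * u k = u k.+1 + c k) -> (r < n)%N -> c (j + r)%N = 1 -> b ^- n <= u j.
Proof.
move=> b1 u0 c0 E rn cr; have b0 : 0 < b by lra.
apply: (@le_trans _ _ (b ^- r.+1)).
  by rewrite lef_pV2 ?posrE ?exprn_gt0 // ler_weXn2l // ltW.
elim: r j cr {rn} => [|r IH] j cr; rewrite -(ler_pM2l b0) E.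
  by rewrite expr1 mulfV ?lt0r_neq0 //; rewrite addn0 in cr; rewrite cr; have := u0 j.+1; lra.
rewrite exprS invfM mulrA mulfV ?lt0r_neq0 // mul1r.
by have := IH j.+1; rewrite addSn -addnS => /(_ cr); have := c0 j; lra.
Qed.

(** With the digits [d], the remainder at time [k + 1] is at least 1 for [b'] but at most [1 - e]
    for [b], while a change of parameter is amplified at most [2 ^+ k.+1] times. *)
Lemma remainder_separation d d' b b' k e : 1 < b < 2 -> 1 < b' < 2 ->
  (forall j, 0 <= remainder d b j <= 1) -> (forall j, 0 <= remainder d' b' j) ->
  (forall i, (i < k)%N -> d i = d' i) -> d k = 0 -> d' k = 1 ->
  remainder d b k.+1 <= 1 - e -> 0 < e ->
  e * 2 ^- k.+1 <= b' - b.
Proof.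
move=> hb hb' H H' Ed dk dk' He e0.
have E j : (j <= k)%N -> remainder d b' j = remainder d' b' j.
  by elim: j => // j IH jk /=; rewrite IH ?(ltnW jk) // Ed.
have Hk : 1 <= b' * remainder d b' k.
  by have := H' k.+1; rewrite /= dk' -E //; lra.
have bb' : b < b'.
  rewrite ltNge; apply/negP => b'b.
  have h0 : 0 <= b' <= b by lra.
  have h1 j : (j <= k)%N -> 0 <= remainder d b' j by move=> /E->.
  have := remainder_mono h0 h1 (leqnn k) => h2.
  have : b' * remainder d b' k <= b * remainder d b k by rewrite ler_pM ?h1 //; lra.
  by move: He; rewrite /= dk; lra.
have h0 : 0 <= b <= b' by lra.
have D0 j : 0 <= remainder d b' j - remainder d b j.
  rewrite subr_ge0; apply: (@remainder_mono _ d b b' j) => // i _.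
  by case/andP: (H i).
have D j : remainder d b' j - remainder d b j <= (2 ^+ j - 1) * (b' - b).
  elim: j => [|j IH]; first by rewrite /= !subrr mul0r.
  rewrite /= exprS.
  have h1 : (b' - b) * remainder d b j <= b' - b.
    by rewrite ler_piMr ?subr_ge0 ?(ltW bb') //; case/andP: (H j).
  have h2 : b' * (remainder d b' j - remainder d b j) <= 2 * (remainder d b' j - remainder d b j).
    by rewrite ler_wpM2r //; lra.
  lra.
have := D k.+1; rewrite [remainder d b' _]/= dk => h1.
have p0 : 0 < 2 ^+ k.+1 :> R by rewrite exprn_gt0.
rewrite ler_pdivrMr //.
have : (b' - b) * 2 ^+ k.+1 = 2 ^+ k.+1 * (b' - b) by rewrite mulrC.
by move: h1 He Hk bb'; set p := 2 ^+ k.+1; lra.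
Qed.

(* 1^(q+4) followed by blocks 0 1 w_i ... w_(i+q-1): the long prefix dominates every tail, and
   each block leaves q of its q + 2 digits free. *)
Definition block_digits (q : nat) (w : nat -> bool) (j : nat) : int :=
  if (j < q + 4)%N then 1 else
  let r := ((j - (q + 4)) %% (q + 2))%N in
  if r == 0%N then 0 else if r == 1%N then 1 else
  (w ((j - (q + 4)) %/ (q + 2) * q + (r - 2))%N : nat)%:Z.

Lemma block_digits01 q w j : block_digits q w j = 0 \/ block_digits q w j = 1.
Proof.
rewrite /block_digits; case: ifP => _; first by right.
case: ifP => _; first by left.
case: ifP => _; first by right.
by case: (w _); [right|left].
Qed.

Lemma modn_window (n c x : nat) : (c < n)%N -> exists2 r, (r < n)%N & (x + r = c %[mod n])%N.
Proof.
move=> cn; have n0 : (0 < n)%N by lia.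
exists ((n + c - x %% n) %% n)%N; first by rewrite ltn_mod.
rewrite modnDmr {1}(divn_eq x n) -addnA subnKC; last first.
  by rewrite (leq_trans (ltnW (ltn_pmod x n0))) // leq_addr.
by rewrite modnMDl modnDl.
Qed.

Lemma block_digits_window1 q w j : exists2 r, (r < q + 2)%N & block_digits q w (j + r) = 1.
Proof.
have [jm|jm] := ltnP j (q + 4).
  by exists 0%N; [rewrite addn2|rewrite addn0 /block_digits jm].
have [|r rq E] := @modn_window (q + 2) 1 (j - (q + 4)); first lia.
exists r => //; rewrite /block_digits ifF; last by apply/negbTE; lia.
rewrite (_ : (j + r - (q + 4) = j - (q + 4) + r)%N); last by lia.
by rewrite E modn_small //; lia.
Qed.

Lemma block_digits_window0 q w j : (q + 4 <= j)%N ->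
  exists2 r, (r < q + 2)%N & block_digits q w (j + r) = 0.
Proof.
move=> jm; have [|r rq E] := @modn_window (q + 2) 0 (j - (q + 4)); first lia.
exists r => //; rewrite /block_digits ifF; last by apply/negbTE; lia.
rewrite (_ : (j + r - (q + 4) = j - (q + 4) + r)%N); last by lia.
by rewrite E modn_small //; lia.
Qed.

(** [q + 6] counts the prefix and the markers 0, 1 of the first block; every completed block of [q]
    free digits adds two more markers. *)
Lemma block_digits_free q w L : (0 < q)%N ->
  block_digits q w (q + 6 + L + 2 * (L %/ q)) = (w L : nat)%:Z.
Proof.
move=> q0; rewrite /block_digits ifF; last by apply/negbTE; move: (L %/ q)%N => u; lia.
have EL := divn_eq L q; have rq : (L %% q < q)%N by rewrite ltn_mod.
set u := (L %/ q)%N in EL *; set r := (L %% q)%N in EL rq *.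
rewrite (_ : (q + 6 + L + 2 * u - (q + 4) = u * (q + 2) + (r + 2))%N); last first.
  by rewrite mulnDr {1}EL; lia.
rewrite modnMDl divnMDl; last by lia.
rewrite modn_small ?divn_small; [|lia|lia].
rewrite ifF; last by apply/negbTE; lia.
rewrite ifF; last by apply/negbTE; lia.
by rewrite addn0 addnK -EL.
Qed.

(** A 1 in every window bounds the remainders away from 0, and a 0 in every window past the prefix
    bounds them away from [(b - 1)^-1]. The prefix makes [(b - 1)^-1] so close to 1 that they stay
    below 1 and are the orbit of 1. *)
Lemma block_expansion q w : exists b, [/\ 1 < b < 2,
  exists2 e : R, 0 < e & forall i, e <= orb b i 1,
  forall j, 0 <= remainder (block_digits q w) b j <= 1 &
  forall j, (q + 4 <= j)%N -> remainder (block_digits q w) b j <= 1 - 2 ^- (q + 2) / 9].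
Proof.
set d := block_digits q w.
have d1 j : (j < q + 4)%N -> d j = 1 by rewrite /d /block_digits => ->.
have [||||b [/andP[b32 b2] Hb]] := @expansion_exists d.
- exact: block_digits01.
- by apply: d1; lia.
- by apply: d1; lia.
- by have [r _ Er] := @block_digits_window0 q w (q + 4) (leqnn _); eexists; exact: Er.
have b1 : 1 < b by lra.
have b0 : 0 < b by lra.
have dR k : 0 <= ((d k)%:~R : R) <= 1.
  by case: (block_digits01 q w k); rewrite -/d => ->; rewrite ?lexx ler01.
have low j : b ^- (q + 2) <= remainder d b j.
  have [r rq Er] := block_digits_window1 q w j.
  apply: (@backward_ge (remainder d b) (fun k => (d k)%:~R) b _ j r) => //.
  - by move=> k; case/andP: (Hb k).
  - by move=> k; case/andP: (dR k).
  - by move=> k /=; rewrite subrK.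
  - by rewrite /d Er.
pose W j := (b - 1)^-1 - remainder d b j.
have b10 : 0 < b - 1 by lra.
have bi : (b - 1) * (b - 1)^-1 = 1 by rewrite mulfV ?lt0r_neq0.
have W0 k : 0 <= W k by rewrite subr_ge0; case/andP: (Hb k).
have WE k : b * W k = W k.+1 + (1 - (d k)%:~R) by rewrite /W /=; move: bi; lra.
have upp j : (q + 4 <= j)%N -> b ^- (q + 2) <= W j.
  move=> jq; have [r rq Er] := block_digits_window0 w jq.
  apply: (@backward_ge W (fun k => 1 - (d k)%:~R) b _ j r) => //.
  - by move=> k; rewrite subr_ge0; case/andP: (dR k).
  - by rewrite /d Er subr0.
have Wm j : (j <= q + 4)%N -> b ^+ j * W 0 = W j.
  elim: j => [|j IH] jq; first by rewrite mul1r.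
  by rewrite exprS -mulrA IH ?(ltnW jq) // WE d1 // subrr addr0.
have big0 k : 0 < b ^- k by rewrite invr_gt0 exprn_gt0.
(* As [b >= 3 / 2], this is at most [8 / 9] of [b ^- (q + 2)], which leaves the ninth in the
   claim. *)
have W00 : W 0 <= 2 * b ^- (q + 4).
  have -> : W 0 = b ^- (q + 4) * W (q + 4)%N.
    by rewrite -(Wm (q + 4)%N) // mulrA mulVf ?mul1r // gt_eqF // exprn_gt0.
  rewrite mulrC ler_pM2r // /W; have /andP[h _] := Hb (q + 4)%N.
  have : (b - 1)^-1 <= 2 by rewrite -(ler_pM2l b10) bi; lra.
  lra.
have b22 : 9 * b ^- (q + 4) <= 4 * b ^- (q + 2).
  have -> : b ^- (q + 4) = b ^- (q + 2) * b ^- 2 by rewrite -invfM -exprD -addnA.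
  have h : b ^- 2 <= 4 / 9.
    have u1 : b ^- 2 * b ^+ 2 = 1 by rewrite mulVf // gt_eqF // exprn_gt0.
    have b94 : 9 / 4 <= b ^+ 2 by rewrite expr2; nra.
    have : b ^- 2 * (9 / 4) <= b ^- 2 * b ^+ 2 by rewrite ler_pM2l.
    by rewrite u1; lra.
  have : b ^- (q + 2) * b ^- 2 <= b ^- (q + 2) * (4 / 9) by rewrite ler_pM2l.
  lra.
have two : 2 ^- (q + 2) <= b ^- (q + 2).
  by rewrite lef_pV2 ?posrE ?exprn_gt0 // lerXn2r ?nnegrE; lra.
have high j : (q + 4 <= j)%N -> remainder d b j <= 1 - 2 ^- (q + 2) / 9.
  move=> jq; have := upp j jq; move: W00; rewrite /W [remainder d b 0]/=; lra.
have lt1 j : (0 < j)%N -> remainder d b j < 1.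
  move=> j0; have [jq|jq] := leqP (q + 4) j.
    have p2 : 0 < 2 ^- (q + 2) :> R by rewrite invr_gt0 exprn_gt0.
    by have := high j jq; lra.
  have : (j <= q + 4)%N by apply: ltnW.
  elim: j j0 {jq} => // -[_ _ _|j IH _ jq] /=; first by rewrite d1; [lra|lia].
  have h1 : remainder d b j.+1 < 1 by apply: IH => //; exact: ltnW.
  rewrite -/(remainder d b j.+1) d1 //.
  have : b * remainder d b j.+1 < b * 1 by rewrite ltr_pM2l.
  lra.
exists b; split=> //.
- by rewrite b1.
- exists (b ^- (q + 2)) => // i.
  rewrite (@remainder_orb _ d b i) // => j /andP[j0 _].
  by rewrite lt1 // andbT; case/andP: (Hb j).
- move=> j; case/andP: (Hb j) => -> _ /=.
  by case: j => [|j]; [rewrite /= lexx|rewrite ltW // lt1].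
Qed.

(** Expansions from sequences differing at [L] first differ after the prefix and no later than the
    place of free digit [L]. *)
Lemma block_parameters q : (0 < q)%N -> exists2 e : R, 0 < e & exists B : (nat -> bool) -> R,
  (forall w, 1 < B w < 2 /\ exists2 e : R, 0 < e & forall i, e <= orb (B w) i 1) /\
  forall w w' L, w L != w' L -> e * 2 ^- (L + 2 * (L %/ q)) <= `|B w - B w'|.
Proof.
move=> q0; have [B HB] := choice (block_expansion q).
set e := 2 ^- (q + 2) / 9 : R.
have e0 : 0 < e by rewrite divr_gt0 // invr_gt0 exprn_gt0.
exists (e * 2 ^- (q + 7)); first by rewrite mulr_gt0 // invr_gt0 exprn_gt0.
exists B; split=> [w|w w' L ww']; first by have [? ? _ _] := HB w.
set k0 := (q + 6 + L + 2 * (L %/ q))%N.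
have : exists k, block_digits q w k != block_digits q w' k.
  by exists k0; rewrite /k0 !block_digits_free //; case: (w L) (w' L) ww' => -[].
move=> ex; have [k Hk Hmin] := ex_minnP ex.
have kk0 : (k <= k0)%N.
  by apply: Hmin; rewrite /k0 !block_digits_free //; case: (w L) (w' L) ww' => -[].
have low i : (i < k)%N -> block_digits q w i = block_digits q w' i.
  by move=> ik; apply/eqP/negbNE/negP => /Hmin; rewrite leqNgt ik.
have kq : (q + 4 <= k.+1)%N.
  rewrite leqNgt; apply/negP => kq; move: Hk.
  by rewrite /block_digits (_ : (k < q + 4)%N) ?eqxx //; lia.
have [hb _ Hb1 Hb2] := HB w; have [hb' _ Hb1' Hb2'] := HB w'.
have H : e * 2 ^- k.+1 <= `|B w - B w'|.
  have [d0|d1] := block_digits01 q w k; have [d0'|d1'] := block_digits01 q w' k.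
  - by rewrite d0 d0' in Hk.
  - rewrite distrC; apply: le_trans (ler_norm _).
    apply: (@remainder_separation (block_digits q w) (block_digits q w') _ _ k) => //.
      by move=> j; case/andP: (Hb1' j).
    exact: Hb2.
  - apply: le_trans (ler_norm _).
    apply: (@remainder_separation (block_digits q w') (block_digits q w) _ _ k) => //.
    + by move=> j; case/andP: (Hb1 j).
    + by move=> i /low.
    + exact: Hb2'.
  - by rewrite d1 d1' in Hk.
apply: le_trans H.
rewrite -mulrA ler_pM2l // -invfM -exprD lef_pV2 ?posrE ?exprn_gt0 //.
rewrite ler_weXn2l ?ler1n //; move: kk0; rewrite /k0.
by move: (L %/ q)%N => u; clear; lia.
Qed.

(** Binary digits, read off the doubling map [beta_map 2]. *)
Definition bit y i : bool := 1 <= 2 * orb 2 i y.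

Lemma bit_dist y y' L : 0 <= y < 1 -> 0 <= y' < 1 ->
  (forall i, (i < L)%N -> bit y i = bit y' i) -> `|y - y'| <= 2 ^- L.
Proof.
move=> hy hy' H.
have step x : 0 <= x < 1 -> beta_map 2 x = 2 * x - (1 <= 2 * x)%R%:R.
  move=> hx; case: (lerP 1 (2 * x)) => h; rewrite /= ?mulr1n ?mulr0n ?subr0.
    by apply: (@beta_map_eq _ _ _ _ 1); [apply/andP; split; lra|lra].
  by apply: (@beta_map_eq _ _ _ _ 0); [apply/andP; split; lra|lra].
have D : orb 2 L y - orb 2 L y' = 2 ^+ L * (y - y').
  elim: L H => [|L IH] H; first by rewrite mul1r.
  have /IH{}IH : forall i, (i < L)%N -> bit y i = bit y' i by move=> i iL; apply: H; exact: ltnW.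
  rewrite !iterS !step ?orb_itv // -/(bit y L) -/(bit y' L) H //.
  by rewrite exprS -mulrA -IH; lra.
have p0 : 0 < 2 ^+ L :> R by rewrite exprn_gt0.
rewrite -(ler_pM2l p0) mulfV ?lt0r_neq0 // -{1}(gtr0_norm p0) -normrM -D.
have := orb_itv 2 L hy; have := orb_itv 2 L hy'.
by rewrite ler_norml => /andP[? ?] /andP[? ?]; apply/andP; split; lra.
Qed.

Lemma bit_sep y y' : 0 <= y < 1 -> 0 <= y' < 1 -> y != y' ->
  exists2 L, bit y L != bit y' L & `|y - y'| <= 2 ^- L.
Proof.
move=> hy hy' yy'.
have ex : exists L, bit y L != bit y' L.
  apply: contrapT => H.
  have all_eq i : bit y i = bit y' i.
    by apply/eqP/negbNE/negP => h; apply: H; exists i.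
  have d0 : 0 < `|y - y'| by rewrite normr_gt0 subr_eq0.
  have [|N /(_ _ (leqnn N))] := @exprV_small _ 2 `|y - y'| _ d0; first lra.
  by have := @bit_dist y y' N hy hy' (fun i _ => all_eq i); lra.
have [L HL Hmin] := ex_minnP ex.
exists L => //; apply: bit_dist => // i iL.
by apply/eqP/negbNE/negP => /Hmin; rewrite leqNgt iL.
Qed.

Lemma holder_parameters s : 0 <= s < 1 -> exists2 C : R, 0 < C & exists g : R -> R,
  (forall y, 1 < g y < 2 /\ exists2 e : R, 0 < e & forall i, e <= orb (g y) i 1) /\
  forall y y', 0 <= y < 1 -> 0 <= y' < 1 -> `|y - y'| <= C * `|g y - g y'| `^ s.
Proof.
move=> /andP[s0 s1].
(* [(1 - s) * q > 2] makes the markers cheap: [s * (L + 2 * (L %/ q)) <= L]. *)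
pose q := (Num.bound `|2 / (1 - s)|).+1.
have sq : 2 < (1 - s) * q%:R.
  have s10 : 0 < 1 - s by lra.
  rewrite mulrC -ltr_pdivrMr //; apply: le_lt_trans (ler_norm _) _.
  apply: lt_trans (archi_boundP (normr_ge0 _)) _.
  by rewrite ltr_nat.
have [e e0 [B [HB1 HB2]]] := @block_parameters q isT.
have es0 : 0 < e `^ s by apply: powR_gt0.
exists (e `^ s)^-1; first by rewrite invr_gt0.
exists (fun y => B (bit y)); split=> [y|y y' hy hy']; first exact: HB1.
have [->|yy'] := eqVneq y y'.
  by rewrite subrr normr0 mulr_ge0 ?invr_ge0 ?powR_ge0.
have [L HL dL] := bit_sep hy hy' yy'.
apply: le_trans dL _.
rewrite -(ler_pM2l es0) mulrA mulfV ?lt0r_neq0 // mul1r.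
have H := HB2 _ _ _ HL.
set K := (L + 2 * (L %/ q))%N in H.
have Ks : K%:R * s <= L%:R.
  have Eq : (L %/ q)%:R * q%:R <= L%:R :> R by rewrite -natrM ler_nat leq_divM.
  have h1 : s * (2 * (L %/ q)%:R) <= (1 - s) * ((L %/ q)%:R * q%:R).
    have u0 : 0 <= (L %/ q)%:R :> R by [].
    have : 2 * (L %/ q)%:R <= ((1 - s) * q%:R) * (L %/ q)%:R :> R by rewrite ler_wpM2r // ltW.
    have : s * (2 * (L %/ q)%:R) <= 1 * (2 * (L %/ q)%:R) :> R.
      by rewrite ler_wpM2r ?mulr_ge0 // ltW.
    lra.
  have h2 : (1 - s) * ((L %/ q)%:R * q%:R) <= (1 - s) * L%:R by rewrite ler_wpM2l //; lra.
  by rewrite /K natrD natrM; lra.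
have half0 : (0 : R) < 2^-1 by rewrite invr_gt0.
have : (e * 2 ^- K) `^ s <= `|B (bit y) - B (bit y')| `^ s.
  apply: ge0_ler_powR => //; rewrite ?nnegrE //.
  by rewrite mulr_ge0 ?(ltW e0) // invr_ge0 exprn_ge0.
apply: le_trans; rewrite powRM ?(ltW e0) ?invr_ge0 ?exprn_ge0 //.
rewrite ler_pM2l // -!exprVn -!powR_mulrn ?(ltW half0) // -powRrM.
by apply: ger_powR => //; rewrite half0 /= invf_le1 //; lra.
Qed.

End PrescribedExpansions.

(** * Hausdorff dimension *)

Section Dimension.
Context {R : realType}.
Implicit Types (A U : set R) (s : R).
Local Notation mu := (@lebesgue_measure R).

Lemma diam_fin U (e : R) : U !=set0 -> (diam U <= e%:E)%E ->
  exists d : R, [/\ 0 <= d, diam U = d%:E & forall x y, U x -> U y -> `|x - y| <= d].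
Proof.
move=> [u Uu] Ue.
have ub x y : U x -> U y -> (`|x - y|%:E <= diam U)%E.
  by move=> Ux Uy; apply: ereal_sup_ubound; exists x, y.
have U0 : (0%:E <= diam U)%E by have := ub u u Uu Uu; rewrite subrr normr0.
have Ufin : diam U \is a fin_num.
  by rewrite fin_numE; move: U0 Ue; case: (diam U).
exists (fine (diam U)); split; first by rewrite fine_ge0.
  by rewrite fineK.
by move=> x y Ux Uy; rewrite -lee_fin fineK // ub.
Qed.

Lemma diam_pow_ge0 s U : (0 <= diam_pow s U)%E.
Proof. by rewrite /diam_pow; case: ifP => // _; exact: poweR_ge0. Qed.

Lemma hausdorff_content_ge0 s e A : (0 <= hausdorff_content s e A)%E.
Proof.
apply: le_ereal_inf_tmp => _ [U _ <-]; apply: nneseries_ge0 => n _ _; exact: diam_pow_ge0.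
Qed.

(* A map g into A that is inverse Hoelder of exponent s pulls covers of A back to covers of
   [0, 1[, whose Lebesgue measures are controlled by the s-th powers of the diameters. *)
Lemma hausdorff_measure_neq0 A s (C : R) (g : R -> R) : 0 < C ->
  (forall y, A (g y)) ->
  (forall y y', 0 <= y < 1 -> 0 <= y' < 1 -> `|y - y'| <= C * `|g y - g y'| `^ s) ->
  0 <= s -> hausdorff_measure s A != 0%E.
Proof.
move=> C0 Ag Hg s0; apply/eqP => H0.
(* A cover of total weight below [1 / (4 * C)] pulls back to intervals of total length below
   [1 / 2], too short to cover [[0, 1[]. *)
have c0 : (hausdorff_content s 1 A < ((4 * C)^-1)%:E)%E.
  apply: (@le_lt_trans _ _ 0%E); last by rewrite lte_fin invr_gt0 mulr_gt0.
  by rewrite -H0; apply: ereal_sup_ubound; exists 1 => //=.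
have [_ [U [HU AU] <-] Hlt] := ereal_inf_lt c0.
pose V k : set R := [set y | 0 <= y < 1 /\ U k (g y)].
have HI k : exists I : set R, [/\ measurable I, V k `<=` I &
    (mu I <= (2 * C)%:E * diam_pow s (U k))%E].
  have [[y0 [y001 Uy0]]|V0] := pselect (V k !=set0); last first.
    exists set0; split=> //; first by move=> y Vy; case: V0; exists y.
    by rewrite measure0 mule_ge0 ?diam_pow_ge0 // lee_fin mulr_ge0 // ltW.
  have Uk0 : U k !=set0 by exists (g y0).
  have [d [d0 Ed Hd]] := diam_fin Uk0 (HU k).
  pose r := C * d `^ s.
  have r0 : 0 <= r by rewrite mulr_ge0 ?(ltW C0) // powR_ge0.
  exists `[y0 - r, y0 + r]%classic; split=> //.
    move=> y [y01 Uy]; rewrite /= in_itv /= -ler_distl.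
    apply: le_trans (Hg _ _ y01 y001) _.
    rewrite ler_pM2l //; apply: ge0_ler_powR => //; rewrite ?nnegrE //.
    exact: Hd.
  have -> : diam_pow s (U k) = (d `^ s)%:E.
    by rewrite /diam_pow ifF ?Ed ?poweR_EFin //; apply/negbTE/set0P.
  rewrite lebesgue_measure_itv /= -EFinM lte_fin; case: ifP => _.
    by rewrite -EFinB lee_fin /r; lra.
  by rewrite lee_fin mulr_ge0 ?powR_ge0 // mulr_ge0 // ltW.
have [I HI'] := choice HI.
have cov : `[0, 1[%classic `<=` \bigcup_k I k.
  move=> y; rewrite /= in_itv /= => y01.
  have [k _ Uk] := AU _ (Ag y); exists k => //.
  by have [_ VI _] := HI' k; apply: VI.
have : (mu `[0%R, 1%R[ <= \sum_(0 <= k <oo) mu (I k))%E.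
  apply: measure_sigma_subadditive => // k.
  by have [] := HI' k.
apply/negP; rewrite -ltNge.
apply: (@le_lt_trans _ _ (\sum_(0 <= k <oo) (2 * C)%:E * diam_pow s (U k))%E).
  by apply: lee_nneseries => [k _ _|k _]; [exact: measure_ge0|have [] := HI' k].
rewrite nneseriesZl; last by move=> k _; exact: diam_pow_ge0.
apply: (@lt_trans _ _ ((2 * C)%:E * ((4 * C)^-1)%:E)%E).
  by rewrite lte_pmul2l // lte_fin mulr_gt0.
rewrite lebesgue_measure_itv /= lte_fin ltr01 -EFinB -EFinM lte_fin subr0.
have : 4 * C * (4 * C)^-1 = 1 by rewrite mulfV // gt_eqF // mulr_gt0.
by lra.
Qed.

Lemma hausdorff_dim_le1 A : A `<=` `[1, 2]%classic -> (hausdorff_dim A <= 1%:E)%E.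
Proof.
move=> A12.
apply/lee_addgt0Pr => e e0; rewrite -EFinD.
apply: ereal_inf_lbound; exists (1 + e) => //; split; first by rewrite addr_ge0 // ltW.
apply/eqP; rewrite eq_le; apply/andP; split; last first.
  apply: le_trans (hausdorff_content_ge0 (1 + e) 1 A) _.
  by apply: ereal_sup_ubound; exists 1 => //=.
apply: ge_ereal_sup => _ [d /= d0 <-].
apply/lee_addgt0Pr => r r0; rewrite add0e.
have ei0 : 0 < r `^ e^-1 by apply: powR_gt0.
(* Cutting [[1, 2]] into [N] equal intervals gives mesh [1 / N <= d] and total weight
   [N * N^-(1 + e) = N^-e <= r]. *)
pose N := (Num.bound (d^-1 + (r `^ e^-1)^-1)).+1.
have Nb : d^-1 + (r `^ e^-1)^-1 < N%:R.
  apply: lt_trans (archi_boundP _) _; first by rewrite addr_ge0 // invr_ge0 ltW.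
  by rewrite ltr_nat.
have N1 : (0 < N)%N by [].
clearbody N; have N0 : 0 < N%:R :> R by rewrite ltr0n.
have Nd : N%:R^-1 <= d.
  rewrite invf_ple ?posrE //; apply/ltW/(le_lt_trans _ Nb).
  by rewrite lerDl invr_ge0 ltW.
have Nr : N%:R^-1 <= r `^ e^-1.
  rewrite invf_ple ?posrE //; apply/ltW/(le_lt_trans _ Nb).
  by rewrite lerDr invr_ge0 ltW.
have Ni0 : 0 < N%:R^-1 :> R by rewrite invr_gt0.
pose U k : set R := if (k < N)%N then `[1 + k%:R / N%:R, 1 + k.+1%:R / N%:R]%classic else set0.
have dU k : (diam (U k) <= (N%:R^-1)%:E)%E.
  apply: ge_ereal_sup => _ [x [y [Ux Uy ->]]]; rewrite lee_fin.
  move: Ux Uy; rewrite /U; case: ifP => // _; rewrite /= !in_itv /= -natr1 mulrDl mul1r.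
  by move=> /andP[? ?] /andP[? ?]; rewrite ler_norml; apply/andP; split; lra.
apply: (@le_trans _ _ (\sum_(0 <= k <oo) diam_pow (1 + e) (U k))%E).
  apply: ereal_inf_lbound; exists U => //; split.
    by move=> k; apply: le_trans (dU k) _; rewrite lee_fin.
  move=> x /A12; rewrite /= in_itv /= => /andP[x1 x2].
  have x0 : 0 <= (x - 1) * N%:R by rewrite mulr_ge0 ?subr_ge0 // ltW.
  have [xN|xN] := eqVneq x 2.
    exists N.-1 => //; rewrite /U ltn_predL N1 /= in_itv /= xN prednK //.
    rewrite mulfV ?lt0r_neq0 // lexx andbT.
    have : N.-1%:R / N%:R <= 1 :> R by rewrite ler_pdivrMr // mul1r ler_nat leq_pred.
    lra.
  have x2' : x < 2 by rewrite lt_neqAle xN.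
  exists (Num.truncn ((x - 1) * N%:R)) => //.
  have /andP[t1 t2] := truncn_itv x0.
  rewrite /U ifT.
    rewrite /= in_itv /=; apply/andP; split.
      by rewrite -lerBrDl ler_pdivrMr.
    by rewrite -lerBlDl ler_pdivlMr // ltW.
  rewrite -(ltr_nat R); apply: le_lt_trans t1 _.
  by rewrite -{2}[N%:R]mul1r ltr_pM2r //; lra.
apply: lime_le; first by apply: is_cvg_nneseries => k _ _; exact: diam_pow_ge0.
apply: nearW => n.
have dp k : (diam_pow (1 + e) (U k) <= if (k < N)%N then ((N%:R^-1) `^ (1 + e))%:E else 0)%E.
  rewrite /diam_pow; case: eqVneq => [_|U0].
    by case: ifP => // _; rewrite lee_fin powR_ge0.
  have [kN|Nk] := ltnP k N; last by move: U0; rewrite /U ltnNge Nk eqxx.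
  have [d' [d'0 Ed' _]] := diam_fin ((set0P _).1 U0) (dU k).
  have := dU k; rewrite Ed' lee_fin => d'N.
  by rewrite poweR_EFin lee_fin ge0_ler_powR ?nnegrE // ?(ltW Ni0) // addr_ge0 // ltW.
have part : (\sum_(0 <= k < n) diam_pow (1 + e) (U k) <=
    ((minn n N)%:R * (N%:R^-1) `^ (1 + e))%:E)%E.
  elim: n => [|n IH]; first by rewrite big_geq // min0n mul0r.
  rewrite big_nat_recr //=; apply: le_trans (leeD IH (dp n)) _.
  case: ifP => nN.
    by rewrite -EFinD lee_fin (minn_idPl nN) (minn_idPl (ltnW nN)) -natr1 mulrDl mul1r.
  have Nn : (N <= n)%N by rewrite leqNgt nN.
  by rewrite adde0 (minn_idPr Nn) (minn_idPr (leqW Nn)).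
apply: le_trans part _; rewrite lee_fin.
have pge0 : 0 <= N%:R^-1 `^ (1 + e) :> R by exact: powR_ge0.
apply: (@le_trans _ _ (N%:R * (N%:R^-1) `^ (1 + e))).
  by rewrite ler_wpM2r // ler_nat geq_minr.
rewrite powRD; last by rewrite (gt_eqF Ni0) implybT.
rewrite powRr1 ?(ltW Ni0) // mulrA mulfV ?lt0r_neq0 // mul1r.
have -> : r = (r `^ e^-1) `^ e by rewrite -powRrM mulVf ?lt0r_neq0 // powRr1 // ltW.
by apply: ge0_ler_powR; rewrite ?nnegrE ?(ltW e0) ?(ltW Ni0) // ltW.
Qed.

End Dimension.

Theorem theorem2 (R : realType) :
  {ae (@lebesgue_measure R), forall beta : R, 1 < beta < 2 ->
    [/\ infinite_near0 (isolated (bifurcation_set beta)),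
        infinite_near0
          (bifurcation_set beta `&` limit_point (bifurcation_set beta)),
        infinite_near0 (isolated (bifurcation_set_plus beta)) &
        infinite_near0
          (bifurcation_set_plus beta `&` limit_point (bifurcation_set_plus beta))]
    /\ ~ cantor_set (closure (bifurcation_set beta))
    /\ ~ cantor_set (closure (bifurcation_set_plus beta))}
  /\
  hausdorff_dim [set beta : R | 1 < beta < 2 /\
    exists2 delta : R, 0 < delta &
      cantor_set (closure (bifurcation_set_plus beta) `&` `[0, delta])] = 1%E.
Proof.
split.
  have := @ae_halving R; apply: negligibleS => b /= nH H; apply: nH => hb.
  have [I1 I2] := isolated_near0 hb (H hb).
  have A2 := accumulation_near0 hb.
  have b1 : 1 < b by case/andP: hb.
  have nonempty (A : set R) : infinite_near0 A -> A !=set0.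
    move=> /(_ 1 ltr01) inf; apply/set0P/eqP => A0; apply: inf.
    by rewrite A0 set0I; exact: finite_set0.
  split; last by split; apply/isolated_closure_not_cantor/nonempty.
  (* [E_beta] inherits the accumulation points of its subset [E_beta^+]. *)
  split=> // d d0 fin; apply: (A2 d d0); apply: sub_finite_set fin.
  move=> x [[Ex Lx] dx]; split=> //; split; first exact: bifurcation_set_plus_sub Ex.
  by apply: limit_point_sub Lx; exact: bifurcation_set_plus_sub.
apply/eqP; rewrite eq_le; apply/andP; split.
  by apply: hausdorff_dim_le1 => b [/andP[b1 b2] _]; rewrite /= in_itv /= !ltW.
apply: le_ereal_inf_tmp => _ [s [s0 Hs] <-]; rewrite lee_fin leNgt; apply/negP => s1.
have [|C C0 [g [Hg HC]]] := @holder_parameters R s; first by rewrite s0.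
move: Hs; apply/eqP; apply: (hausdorff_measure_neq0 C0 _ HC s0) => y.
have [hb [e e0 He]] := Hg y; split=> //.
exact: cantor_near0 hb e0 He.
Qed.
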